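(* Let $(M,g)$ be a finite dimensional Riemannian manifold or, more generally, a robust Riemannian manifold (possibly infinite dimensional). Let $\alpha,\beta,\gamma,\delta\in\Omega^1_g(M)$ be closed 1-forms. Then $$g\big(R(\alpha^\sharp,\beta^\sharp)\gamma^\sharp,\delta^\sharp\big)=R_1+R_2+R_3,$$ where $$\begin{aligned} R_1&=\tfrac14\Big(-\alpha^\sharp\gamma^\sharp\delta(\beta^\sharp)+\alpha^\sharp\delta^\sharp\beta(\gamma^\sharp)+\beta^\sharp\gamma^\sharp\delta(\alpha^\sharp)-\beta^\sharp\delta^\sharp\alpha(\gamma^\sharp)\\ &\qquad-\gamma^\sharp\alpha^\sharp\delta(\beta^\sharp)+\gamma^\sharp\beta^\sharp\delta(\alpha^\sharp)+\delta^\sharp\alpha^\sharp\beta(\gamma^\sharp)-\delta^\sharp\beta^\sharp\alpha(\gamma^\sharp)\Big),\\ R_2&=\tfrac14\Big(-g^{-1}\big(d(\gamma(\beta^\sharp)),d(\delta(\alpha^\sharp))\big)+g^{-1}\big(d(\gamma(\alpha^\sharp)),d(\delta(\beta^\sharp))\big)\Big),\\ R_3&=\tfrac14\Big(g\big([\delta^\sharp,\alpha^\sharp],[\beta^\sharp,\gamma^\sharp]\big)-g\big([\delta^\sharp,\beta^\sharp],[\alpha^\sharp,\gamma^\sharp]\big)+2g\big([\alpha^\sharp,\beta^\sharp],[\gamma^\sharp,\delta^\sharp]\big)\Big). \end{aligned}$$ In particular, for the numerator of sectional curvature, $$g\big(R(\alpha^\sharp,\beta^\sharp)\beta^\sharp,\alpha^\sharp\big)=R_1+R_2+R_3,$$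 where now $$\begin{aligned} R_1&=\tfrac12\Big(\alpha^\sharp\alpha^\sharp(\|\beta\|^2)-(\alpha^\sharp\beta^\sharp+\beta^\sharp\alpha^\sharp)g^{-1}(\alpha,\beta)+\beta^\sharp\beta^\sharp(\|\alpha\|^2)\Big)\\ &=\tfrac12\Big(\alpha^\sharp\beta([\alpha^\sharp,\beta^\sharp])-\beta^\sharp\alpha([\alpha^\sharp,\beta^\sharp])\Big),\\ R_2&=\tfrac14\Big(\|d(g^{-1}(\alpha,\beta))\|^2-g^{-1}\big(d(\|\alpha\|^2),d(\|\beta\|^2)\big)\Big),\\ R_3&=-\tfrac34\big\|[\alpha^\sharp,\beta^\sharp]\big\|_g^2 . \end{aligned}$$
   Context: Notation. For a weak Riemannian manifold $(M,g)$, view $g_x$ as an injective map $T_xM\to T_x^*M$ (bijective in finite dimensions). Its image $g(TM)\subset T^*M$ is the $g$-smooth cotangent bundle and $\Omega^1_g(M)=\Gamma(g(TM))$ is the space of its smooth sections; in finite dimensions $\Omega^1_g(M)=\Omega^1(M)$. For $\alpha\in\Omega^1_g(M)$, $\alpha^\sharp=g^{-1}\alpha$ is the dual vector field. $g^{-1}$ is the induced metric on $g(TM)$: $g^{-1}(\alpha,\beta)=g(\alpha^\sharp,\beta^\sharp)=\alpha(\beta^\sharp)=\beta(\alpha^\sharp)$, and $\|\alpha\|^2=g^{-1}(\alpha,\alpha)$. A 1-form $\alpha\in\Omega^1_g(M)$ is closed if $d\alpha=0$, where $d\alpha(X,Y)=X(\alpha(Y))-Y(\alpha(X))-\alpha([X,Y])$.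 A vector field acts on functions as a derivation, so for example $\alpha^\sharp\gamma^\sharp\delta(\beta^\sharp)$ means the derivative along $\alpha^\sharp$ of the derivative along $\gamma^\sharp$ of the function $\delta(\beta^\sharp)$. $\nabla$ is the Levi-Civita covariant derivative and $R(X,Y)Z=\nabla_X\nabla_YZ-\nabla_Y\nabla_XZ-\nabla_{[X,Y]}Z$. A convenient weak Riemannian manifold is a smooth manifold $M$ modelled on convenient vector spaces (in the sense of Kriegl–Michor; complete locally convex vector spaces are examples), with a smooth map $g:TM\times_MTM\to\mathbb R$ that is a positive definite symmetric bilinear form on each $T_xM$. It is called robust if the following two conditions hold. (1) The Levi-Civita covariant derivative exists, in the following sense: in each chart $U$, with $V_U$ the space of constant vector fields on $U$, there are smooth maps $\mathrm{grad}_1g,\mathrm{grad}_2g:U\times V_U\to V_U$, quadratic in $V_U$, with $D_{x,Z}g_x(X,X)=g_x(Z,\mathrm{grad}_1g(x)(X,X))$ and $D_{x,X}g_x(X,Z)=g_x(\mathrm{grad}_2g(x)(X,X),Z)$ for all $X,Z\in V_U$. Here $D_{x,Z}$ is the derivative at $x$ in direction $Z$. (2) The Hilbert space completions $\overline{T_xM}$ of $T_xM$ with respect to $g_x$ form a smooth vector bundle over $M$. That is, in each chart the local inner products $g_x$ on the modelling space are equivalent, with completion a Hilbert space $\mathcal H$. The transition functions of $TM$ extend to bounded linear isomorphisms of $\mathcal H$, and they are smooth as maps into $L(\mathcal H,\mathcal H)$. *)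

(* Defs.v *)
From HB Require Import structures.
From mathcomp Require Import all_boot all_order all_algebra.
From mathcomp Require Import all_classical all_reals all_analysis.

Set Implicit Arguments.
Unset Strict Implicit.
Unset Printing Implicit Defensive.

Import Order.TTheory GRing.Theory Num.Theory.
Import numFieldNormedType.Exports.

Local Open Scope classical_set_scope.
Local Open Scope ring_scope.

(* Convenient calculus, after Kriegl and Michor, "The Convenient Setting of
   Global Analysis": a map is smooth when it sends smooth curves to smooth
   curves; it need not be continuous for the given locally convex topology. *)
Section ConvenientCalculus.
Context {R : realType}.
Implicit Types E F G : tvsType R.

Definition slope E F (f : E -> F) (x v : E) : R -> F :=
  fun h => h^-1 *: (f (x + h *: v) - f x).

(* The library's directional derivative requires normed modules; this is the
   same limit, for a target that is only a topological vector space. *)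
Definition dirD E F (f : E -> F) (x v : E) : F :=
  xget 0 [set l : F | slope f x v h @[h --> 0^'] --> l].

Definition velocity E (c : R^o -> E) : R^o -> E := fun t => dirD c t 1.

Definition smooth_curve E (c : R^o -> E) : Prop :=
  forall (n : nat) (t : R^o),
    exists l : E, slope (iter n (@velocity E) c) t 1 h @[h --> 0^'] --> l.

Definition smooth_on E F (U : set E) (f : E -> F) : Prop :=
  forall c : R^o -> E, smooth_curve c -> (forall t, U (c t)) ->
    smooth_curve (f \o c).

(* Open for the final topology with respect to all smooth curves *)
Definition cinfty_open E (U : set E) : Prop :=
  forall c : R^o -> E, smooth_curve c -> open (c @^-1` U).

(* Local convexity is part of [tvsType].  Of the equivalent completeness
   conditions which Kriegl and Michor take as the definition,
   this is "a scalarwise smooth curve is smooth". *)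
Definition convenient E : Prop :=
  hausdorff_space E /\
  forall c : R^o -> E,
    (forall l : {linear E -> R^o}, continuous l -> smooth_curve (l \o c)) ->
    smooth_curve c.

Definition bilinear_map E F G (b : E -> F -> G) : Prop :=
  (forall u, linear (b u)) /\ (forall v, linear (b^~ v)).

Definition quadratic_map E F (q : E -> F) : Prop :=
  exists2 b : E -> E -> F, bilinear_map b & forall v, q v = b v v.

(* The bracket of derivations, so that [X, Y] f = X (Y f) - Y (X f) *)
Definition lbracket E (X Y : E -> E) : E -> E :=
  fun x => dirD Y x (X x) - dirD X x (Y x).

Definition lcov E (Gam : E -> E -> E -> E) (X Y : E -> E) : E -> E :=
  fun x => dirD Y x (X x) + Gam x (X x) (Y x).

End ConvenientCalculus.

Section HilbertOperators.
Context {R : realType}.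

Definition is_hilbert (H : completeNormedModType R) : Prop :=
  exists ip : H -> H -> R^o,
    [/\ bilinear_map ip, forall v w, ip v w = ip w v &
        forall v, ip v v = `|v| ^+ 2].

Definition bounded_linear (H K : normedModType R) (T : H -> K) : Prop :=
  linear T /\ exists C : R, forall v, `|T v| <= C * `|v|.

(* Smooth curves in the Banach space L(H, K) with the operator norm; [D n] is
   the n-th derivative. *)
Definition op_smooth_curve (H K : normedModType R) (T : R -> H -> K) : Prop :=
  exists D : nat -> R -> H -> K,
    [/\ D 0%N = T, forall n t, bounded_linear (D n t) &
        forall n t (e : R), 0 < e -> \forall h \near 0^', forall v,
          `|h^-1 *: (D n (t + h) v - D n t v) - D n.+1 t v| <= e * `|v|].

Definition op_smooth_on (E : tvsType R) (H K : normedModType R)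
    (U : set E) (T : E -> H -> K) : Prop :=
  forall c : R^o -> E, smooth_curve c -> (forall t, U (c t)) ->
    op_smooth_curve (fun t => T (c t)).

End HilbertOperators.

(* A set with a smooth atlas.  The chart [i] is the bijection [coord i] from
   [dom i] onto its image, with inverse [param i]; the values of [coord i] and
   [param i] elsewhere are irrelevant.  No separation axiom is imposed. *)
Record manifold (R : realType) := Manifold {
  carrier :> Type;
  chart : Type;
  model : chart -> tvsType R;
  dom : chart -> set carrier;
  coord : forall i : chart, carrier -> model i;
  param : forall i : chart, model i -> carrier;
  model_convenient : forall i, convenient (model i);
  dom_cover : forall p : carrier, exists i, dom i p;
  coordK : forall i p, dom i p -> param (coord i p) = p;
  overlap_open : forall i j,
    cinfty_open (coord i @` (dom i `&` dom j));
  transition_smooth : forall i j,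
    smooth_on (coord i @` (dom i `&` dom j)) (coord j \o @param i)
}.

Arguments coord {R m} i p.
Arguments param {R m} i x.
Arguments dom {R m} i.
Arguments model {R m} i.

Section Geometry.
Context {R : realType} {M : manifold R}.
Implicit Types (i j : chart M).

Definition cdom i : set (model i) := coord i @` dom i.
Definition overlap i j : set (model i) := coord i @` (dom i `&` dom j).
Definition transition i j : model i -> model j := coord j \o param i.

(* Sections of TM, T*M and the symmetric square of T*M are given by their
   principal parts in all charts, as functions of the coordinates. *)
Definition vfield := forall i, model i -> model i.
Definition oneform := forall i, model i -> model i -> R^o.
Definition metric := forall i, model i -> model i -> model i -> R^o.
Definition christoffel := forall i, model i -> model i -> model i -> model i.

Implicit Types (X Y Z : vfield) (a b : oneform) (g : metric).
Implicit Types (Gam : christoffel).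

Definition smooth_field X : Prop :=
  (forall i, smooth_on (@cdom i) (X i)) /\
  forall i j x, overlap j x ->
    X j (transition j x) = dirD (@transition i j) x (X i x).

Definition weak_riemannian g : Prop :=
  [/\ forall i x, cdom x ->
        [/\ bilinear_map (g i x), forall v w, g i x v w = g i x w v &
            forall v, v != 0 -> 0 < g i x v v],
      forall i, smooth_on [set z : model i * model i * model i | cdom z.1.1]
                          (fun z => g i z.1.1 z.1.2 z.2) &
      forall i j x v w, overlap j x ->
        g j (transition j x) (dirD (@transition i j) x v)
                             (dirD (@transition i j) x w) = g i x v w].

Definition metric_gradients g : Prop :=
  forall i, exists grad1 grad2 : model i -> model i -> model i,
    [/\ smooth_on [set z : model i * model i | cdom z.1]
                  (fun z => grad1 z.1 z.2),
        smooth_on [set z : model i * model i | cdom z.1]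
                  (fun z => grad2 z.1 z.2),
        forall x, cdom x -> quadratic_map (grad1 x) /\ quadratic_map (grad2 x) &
        forall x (v w : model i), cdom x ->
          dirD (fun y => g i y v v) x w = g i x w (grad1 x v) /\
          dirD (fun y => g i y v w) x v = g i x (grad2 x v) w].

(* [H i], with the dense embedding [iota i], is the common Hilbert space
   completion of the model space of the chart [i] for the inner products
   [g i x], which are equivalent to its norm and hence to one another; [T i j x]
   extends the transition of TM from [i] to [j]. *)
Definition completion_bundle g : Prop :=
  exists (H : chart M -> completeNormedModType R)
         (iota : forall i, {linear model i -> H i})
         (T : forall i j, model i -> H i -> H j),
    [/\ forall i, is_hilbert (H i) /\ closure (range (iota i)) = setT,
        forall i x, cdom x -> exists2 C : R, 0 < C &
          forall v : model i, `|iota i v| ^+ 2 <= C * g i x v v /\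
                              g i x v v <= C * `|iota i v| ^+ 2,
        forall i j x, overlap j x ->
          [/\ bounded_linear (T i j x),
              cancel (T i j x) (T j i (transition j x)) &
              forall v,
                T i j x (iota i v) = iota j (dirD (@transition i j) x v)] &
        forall i j, op_smooth_on (@overlap i j) (T i j)].

Definition robust g : Prop :=
  [/\ weak_riemannian g, metric_gradients g & completion_bundle g].

Definition bracket X Y : vfield := fun i => lbracket (X i) (Y i).

(* The Levi-Civita covariant derivative in terms of its Christoffel forms: it
   is torsion free and compatible with the metric.  The test fields are local
   because a convenient manifold may have few global ones.  Since [g] is
   nondegenerate, these conditions determine [Gam i x] on every chart domain;
   its transformation law under chart changes follows. *)
Definition levi_civita g Gam : Prop :=
  [/\ forall i x, cdom x -> bilinear_map (Gam i x),
      forall i, smooth_on [set z : model i * model i * model i | cdom z.1.1]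
                          (fun z => Gam i z.1.1 z.1.2 z.2),
      forall i (X Y : model i -> model i),
        smooth_on (@cdom i) X -> smooth_on (@cdom i) Y ->
        forall x, cdom x ->
          lcov (Gam i) X Y x - lcov (Gam i) Y X x = lbracket X Y x &
      forall i (X Y Z : model i -> model i),
        smooth_on (@cdom i) X -> smooth_on (@cdom i) Y ->
        smooth_on (@cdom i) Z ->
        forall x, cdom x ->
          dirD (fun y => g i y (X y) (Y y)) x (Z x) =
          g i x (lcov (Gam i) Z X x) (Y x) + g i x (X x) (lcov (Gam i) Z Y x)].

Definition nabla Gam X Y : vfield := fun i => lcov (Gam i) (X i) (Y i).

Definition curvature Gam X Y Z : vfield := fun i x =>
  nabla Gam X (nabla Gam Y Z) x - nabla Gam Y (nabla Gam X Z) x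
  - nabla Gam (bracket X Y) Z x.

(* The value at [p] of a chart-compatible expression is read off in some chart
   around [p]. *)
Definition chart_at (p : M) : chart M := projT1 (cid (dom_cover p)).

Definition inner g X Y : M -> R^o := fun p =>
  let x := coord (chart_at p) p in g (chart_at p) x (X _ x) (Y _ x).

Definition pairing a X : M -> R^o := fun p =>
  let x := coord (chart_at p) p in a (chart_at p) x (X _ x).

Definition along X (f : M -> R^o) : M -> R^o := fun p =>
  let x := coord (chart_at p) p in
  dirD (f \o param (chart_at p)) x (X _ x).

Definition dfun (f : M -> R^o) : oneform := fun i x v =>
  dirD (f \o param i) x v.

(* The vector representing [a i x] through [g], which is unique if it exists *)
Definition sharp g a : vfield := fun i x =>
  xget 0 [set v | forall w, a i x w = g i x v w].

(* Smooth sections of the image g(TM) of TM in T*M, whose bundle structure is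
   the one transported from TM; linearity and chart compatibility of [a] follow
   from those of [g] and of the vector field. *)
Definition gsmooth_form g a : Prop :=
  (forall i x, cdom x -> exists v : model i, forall w, a i x w = g i x v w) /\
  smooth_field (sharp g a).

Definition ext_deriv a i (X Y : model i -> model i) (x : model i) : R :=
  dirD (fun y => a i y (Y y)) x (X x) - dirD (fun y => a i y (X y)) x (Y x)
  - a i x (lbracket X Y x).

Definition closed_form a : Prop :=
  forall i (X Y : model i -> model i),
    smooth_on (@cdom i) X -> smooth_on (@cdom i) Y ->
    forall x, cdom x -> ext_deriv a X Y x = 0.

Definition coinner g a b : M -> R^o := inner g (sharp g a) (sharp g b).

End Geometry.
Arguments vfield {R} M.
Arguments oneform {R} M.
Arguments metric {R} M.
Arguments christoffel {R} M.

(* Main.v *)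
Require Import Defs.
From HB Require Import structures.
From mathcomp Require Import all_boot all_order all_algebra.
From mathcomp Require Import all_classical all_reals all_analysis.
From mathcomp Require Import ring lra.

Set Implicit Arguments.
Unset Strict Implicit.
Unset Printing Implicit Defensive.

Import Order.TTheory GRing.Theory Num.Theory.
Import numFieldNormedType.Exports.

Local Open Scope classical_set_scope.
Local Open Scope ring_scope.

(** Write [A] for the vector field dual to a closed 1-form, [<,>] for the metric
    and [nabla] for the covariant derivative.  Closedness means that
    [v |-> nabla_v A] is self-adjoint (closed_form_field).  For such fields
    [d<C, D>] is dual to [nabla_C D + nabla_D C], which is again a field of this
    kind, and Koszul's formula becomes
    [2 <nabla_B C, D> = B<C, D> + D<B, C> - C<B, D>] (ip_igrad, igrad_closed,
    koszul).  Compatibility with the metric gives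
    [<nabla_A nabla_B C, D> = A <nabla_B C, D> - <nabla_B C, nabla_A D>]; after
    Koszul's formula the curvature is a sum of second derivatives of inner
    products and of inner products of first covariant derivatives.  Symmetrizing
    the second derivatives by
    [[X, Y] <Z, W> = <nabla_Z W + nabla_W Z, [X, Y]>] (ip_commutator) and writing
    [[X, Y] = nabla_X Y - nabla_Y X] yields the formula (curvature_chart).  The
    expressions are read off in different charts at different points, and agree
    by the chain rule (along_chart).  The sectional curvature is the special case
    of the forms al, be, be, al; the second expression for its first term comes from
    the vanishing of [d al] and [d be] on the pair of dual fields (pairing_bracket).

    This computation rests on four facts of calculus for maps that are only known
    to send smooth curves to smooth curves: the derivative of a field in the
    direction of a field is smooth (smooth_dirD), sums of smooth functions can be
    differentiated, the chain rule (chain_rule), and the symmetry of second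
    derivatives (dirD_sym).

    Three of these facts concern two parameters at a time, and reduce to
    functions [F] on the plane which are smooth along smooth curves
    (plane_localization): convenient spaces are tested by linear functionals, and
    for the chain rule a curve [c] is written as [c 0 + t q(t)] with [q] smooth
    (smooth_remainder).  That such [F] behave as they should is the elementary
    core of a theorem of Boman.  A smooth curve can be led through any sequence
    converging fast enough, with prescribed small velocities (special_curve);
    therefore directional derivatives of [F] of each order are locally bounded
    (pderiv_bounded), and Taylor expansions along lines hold uniformly in the base
    point.  Expanding the values of [F] at the points [x + h w + h lam v] both
    around [x + h w] in the direction [v] and around [x] in the direction
    [w + lam v], for several numbers [lam], and comparing, one finds the
    derivative in the direction [w] of the Taylor coefficients in the direction
    [v], as a linear combination of Taylor coefficients of the next order
    (tcoef_derivE).  Smoothness, additivity and symmetry follow (smooth_pderiv,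
    pderivD, pderiv_sym). *)

(** * Derivatives of curves in topological vector spaces *)

Section CurveDerivatives.
Context {R : realType}.
Implicit Types E F : tvsType R.

Definition has_deriv E (c : R^o -> E) (t : R^o) (l : E) : Prop :=
  slope c t 1 h @[h --> 0^'] --> l.

Lemma slopeE E (c : R^o -> E) (t : R^o) (h : R) :
  slope c t 1 h = h^-1 *: (c (t + h) - c t).
Proof. by rewrite /slope -[h *: 1]/(h * 1) mulr1. Qed.

(** A directional derivative is the velocity of a curve, so that calculus reduces
    to curves. *)
Lemma dirD_line E F (f : E -> F) (x v : E) :
  dirD f x v = velocity (fun t : R^o => f (x + t *: v)) 0.
Proof.
rewrite /velocity /dirD; congr (xget _ _); apply/funext => l /=.
rewrite (_ : slope f x v = slope (fun t : R^o => f (x + t *: v)) 0 1)//.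
by apply/funext => h; rewrite slopeE /slope scale0r addr0 add0r.
Qed.

(** Caratheodory's form of differentiability: the difference quotient extends
    continuously.  No division is left, so the product and chain rules are
    algebra. *)
Lemma has_derivE E (c : R^o -> E) t l :
  has_deriv c t l <->
  exists q : R^o -> E, (forall h, c (t + h) = c t + h *: q h) /\
    q h @[h --> (0 : R^o)] --> l.
Proof.
split=> [cl|[q [cq ql]]].
  pose q (h : R^o) : E := if h == 0 then l else slope c t 1 h.
  exists q; split=> [h|].
    rewrite /q; have [->|h0] := eqVneq h 0; first by rewrite scale0r !addr0.
    by rewrite slopeE scalerA divff// scale1r [RHS]addrC subrK.
  have q0 : q 0 = l by rewrite /q eqxx.
  rewrite -q0; apply/(continuous_withinNx q 0); rewrite q0.
  apply: cvg_trans cl; apply: near_eq_cvg.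
  near=> h; rewrite /q; case: eqVneq => // h0.
  suff : h != 0 by rewrite h0 eqxx.
  by near: h; exact: nbhs_dnbhs_neq.
apply: cvg_trans (cvg_trans _ ql); last first.
  exact: cvg_app (@nbhs_dnbhs _ (0 : R^o)).
apply: near_eq_cvg; near=> h.
rewrite slopeE cq addrAC subrr add0r scalerA mulVf ?scale1r//.
by near: h; exact: nbhs_dnbhs_neq.
Unshelve. all: by end_near. Qed.

Lemma cvg_addE E (T : Type) (B : set_system T) {FB : Filter B}
    (f g : T -> E) (x y : E) :
  f z @[z --> B] --> x -> g z @[z --> B] --> y ->
  f z + g z @[z --> B] --> x + y.
Proof.
move=> fx gy.
have := @continuous2_cvg T E E E B FB f g +%R x y (@add_continuous _ (x, y)).
by apply.
Qed.

Lemma cvg_scaleE E (T : Type) (B : set_system T) {FB : Filter B}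
    (f : T -> R^o) (g : T -> E) (x : R^o) (y : E) :
  f z @[z --> B] --> x -> g z @[z --> B] --> y ->
  f z *: g z @[z --> B] --> x *: y.
Proof.
move=> fx gy.
have := @continuous2_cvg T R^o E E B FB f g (fun a b => a *: b) x y
  (@scale_continuous _ _ (x, y)).
by apply.
Qed.

Lemma cvg_shift0 (t : R^o) : t + h @[h --> (0 : R^o)] --> t.
Proof.
have : t + h @[h --> (0 : R^o)] --> t + 0.
  exact: (@cvg_addE R^o _ _ _ (fun=> t) id _ _ (cvg_cst _) cvg_id).
by rewrite addr0.
Qed.

Lemma cvg_mul0 (p : R^o -> R^o) (l : R^o) :
  p h @[h --> (0 : R^o)] --> l -> h * p h @[h --> (0 : R^o)] --> (0 : R^o).
Proof.
move=> pl; have : h *: p h @[h --> (0 : R^o)] --> (0 : R^o) *: l.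
  exact: (@cvg_scaleE R^o _ _ _ id p _ _ cvg_id pl).
by rewrite scale0r.
Qed.

Lemma has_deriv_unique E (c : R^o -> E) t l m : hausdorff_space E ->
  has_deriv c t l -> has_deriv c t m -> l = m.
Proof. by move=> hE; exact: cvg_unique. Qed.

Lemma velocity_eq E (c : R^o -> E) t l : hausdorff_space E ->
  has_deriv c t l -> velocity c t = l.
Proof.
move=> hE cl; rewrite /velocity /dirD; case: xgetP => [m _ cm|/(_ l)//].
exact: has_deriv_unique hE cm cl.
Qed.

Lemma dirD_eq E F (f : E -> F) x v l : hausdorff_space F ->
  has_deriv (fun t : R^o => f (x + t *: v)) 0 l -> dirD f x v = l.
Proof. by move=> hF fl; rewrite dirD_line; exact: velocity_eq. Qed.

Lemma near_deriv E (c d : R^o -> E) t l :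
  (\forall s \near t, c s = d s) -> has_deriv c t l -> has_deriv d t l.
Proof.
move=> cd; apply: cvg_trans; apply: near_eq_cvg.
have ct := nbhs_singleton cd.
have : \forall h \near (0 : R^o), c (t + h) = d (t + h).
  exact: cvg_shift0 cd.
move=> /nbhs_dnbhs; apply: filterS => h cdh.
by rewrite !slopeE ct cdh.
Qed.

Lemma has_deriv_cst E (x : E) t : has_deriv (fun=> x) t 0.
Proof.
apply/has_derivE; exists (fun=> 0); split=> [h|]; last exact: cvg_cst.
by rewrite scaler0 addr0.
Qed.

Lemma has_deriv_id t : has_deriv (E := R^o) id t 1.
Proof.
apply/has_derivE; exists (fun=> 1); split=> [h|]; last exact: cvg_cst.
by rewrite -[h *: 1]/(h * 1) mulr1.
Qed.

Lemma has_derivD E (c d : R^o -> E) t l m :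
  has_deriv c t l -> has_deriv d t m ->
  has_deriv (fun s => c s + d s) t (l + m).
Proof.
move=> /has_derivE[p [cp pl]] /has_derivE[q [dq qm]].
apply/has_derivE; exists (fun h => p h + q h); split=> [h|].
  by rewrite cp dq scalerDr addrACA.
exact: cvg_addE.
Qed.

Lemma has_derivZ E (s : R^o -> R^o) (c : R^o -> E) t l m :
  has_deriv s t l -> has_deriv c t m ->
  has_deriv (fun u => s u *: c u) t (s t *: m + l *: c t).
Proof.
move=> /has_derivE[p [sp pl]] /has_derivE[q [cq qm]].
apply/has_derivE.
exists (fun h => (s t *: q h + p h *: c t) + (h * p h) *: q h); split=> [h|].
  rewrite sp cq -[h *: p h]/(h * p h) scalerDl !scalerDr !scalerA -!addrA.
  by rewrite [s t * h]mulrC [h * p h * h]mulrC.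
rewrite -[X in _ --> X]addr0; apply: (@cvg_addE E).
  apply: (@cvg_addE E).
    exact: (@cvg_scaleE E _ _ _ (fun=> s t) q _ _ (cvg_cst _) qm).
  exact: (@cvg_scaleE E _ _ _ p (fun=> c t) _ _ pl (cvg_cst _)).
rewrite -(scale0r m).
exact: (@cvg_scaleE E _ _ _ (fun h => h * p h) q _ _ (cvg_mul0 pl) qm).
Qed.

Lemma has_deriv_comp E (c : R^o -> E) (s : R^o -> R^o) t l m :
  has_deriv s t l -> has_deriv c (s t) m ->
  has_deriv (fun u => c (s u)) t (l *: m).
Proof.
move=> /has_derivE[p [sp pl]] /has_derivE[q [cq qm]].
apply/has_derivE; exists (fun h => p h *: q (h * p h)); split=> [h|].
  by rewrite sp cq scalerA.
apply: cvg_scaleE => //.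
have hp := cvg_mul0 pl.
exact: (@cvg_comp _ _ _ (fun h => h * p h) q _ _ _ hp qm).
Qed.

Lemma has_deriv_affine (a b : R) (t : R^o) :
  has_deriv (E := R^o) (fun t => a + b * t) t b.
Proof.
apply/has_derivE; exists (fun=> b); split=> [h|]; last exact: cvg_cst.
by rewrite mulrDr addrA [h *: b]mulrC.
Qed.

Lemma has_deriv_pair E F (c : R^o -> E) (d : R^o -> F) t l m :
  has_deriv c t l -> has_deriv d t m ->
  has_deriv (E := (E * F)%type) (fun s => (c s, d s)) t (l, m).
Proof.
move=> /has_derivE[p [cp pl]] /has_derivE[q [dq qm]].
apply/has_derivE; exists (fun h => (p h, q h)); split=> [h|].
  by rewrite cp dq.
exact: cvg_pair.
Qed.

Lemma has_deriv_linear E F (f : {linear E -> F}) (c : R^o -> E) t l :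
  continuous f -> has_deriv c t l -> has_deriv (f \o c) t (f l).
Proof.
move=> cf /has_derivE[p [cp pl]]; apply/has_derivE.
exists (f \o p); split=> [h|]; first by rewrite /= cp linearD linearZ.
exact: (@cvg_comp _ _ _ p f _ _ _ pl (cf l)).
Qed.

Lemma has_deriv_continuous E (c : R^o -> E) t l :
  has_deriv c t l -> {for t, continuous c}.
Proof.
move=> /has_derivE[p [cp pl]].
have h1 : c (t + h) @[h --> (0 : R^o)] --> c t.
  apply: cvg_trans (_ : c t + h *: p h @[h --> (0 : R^o)] --> _).
    by apply: near_eq_cvg; near=> h; rewrite cp.
  rewrite -[X in _ --> X]addr0 -(scale0r l).
  apply: (@cvg_addE E _ _ _ (fun=> c t)); first exact: cvg_cst.
  exact: (@cvg_scaleE E _ _ _ id p _ _ cvg_id pl).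
have h2 : s - t @[s --> t] --> (0 : R^o).
  rewrite -(subrr t).
  exact: (@cvg_addE R^o _ _ _ id (fun=> - t) _ _ cvg_id (cvg_cst _)).
have := @cvg_comp _ _ _ (fun s => s - t) (fun h => c (t + h)) _ _ _ h2 h1.
apply: cvg_trans; apply: near_eq_cvg.
by near=> s; rewrite /= addrC subrK.
Unshelve. all: by end_near. Qed.

(** * Smooth curves *)

(** Differentiability of finite order lets the closure properties of smooth
    curves be proved by induction on the order, without formulas for the
    derivatives of higher order. *)
Fixpoint ndiff E (n : nat) (c : R^o -> E) : Prop :=
  if n is m.+1 then
    exists d, (forall t, has_deriv c t (d t)) /\ ndiff m d
  else True.

Lemma ndiffS E n (c : R^o -> E) : ndiff n.+1 c -> ndiff n c.
Proof.
elim: n c => // n IH c [d [cd nd]]; exists d; split => //; exact: IH.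
Qed.

Lemma ndiff_cst E n (x : E) : ndiff n (fun=> x : E).
Proof.
elim: n x => //= n IH x; exists (fun=> 0); split => // t; exact: has_deriv_cst.
Qed.

Lemma ndiff_id n : ndiff (E := R^o) n id.
Proof.
case: n => //= n; exists (fun=> 1); split; last exact: ndiff_cst.
exact: has_deriv_id.
Qed.

Lemma ndiffD E n (c d : R^o -> E) :
  ndiff n c -> ndiff n d -> ndiff n (fun t => c t + d t).
Proof.
elim: n c d => //= n IH c d [c' [cc' nc]] [d' [dd' nd]].
exists (fun t => c' t + d' t); split; last exact: IH.
by move=> t; exact: has_derivD.
Qed.

Lemma ndiffZ E n (s : R^o -> R^o) (c : R^o -> E) :
  ndiff n s -> ndiff n c -> ndiff n (fun t => s t *: c t).
Proof.
elim: n s c => // n IH s c ns nc; have := ndiffS ns; have := ndiffS nc.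
case: ns => s' [ss' ns]; case: nc => c' [cc' nc] nc0 ns0.
exists (fun t => s t *: c' t + s' t *: c t); split.
  by move=> t; exact: has_derivZ.
by apply: ndiffD; exact: IH.
Qed.

Lemma ndiff_comp E n (s : R^o -> R^o) (c : R^o -> E) :
  ndiff n s -> ndiff n c -> ndiff n (fun t => c (s t)).
Proof.
elim: n s c => // n IH s c ns nc; have := ndiffS ns.
case: ns => s' [ss' ns]; case: nc => c' [cc' nc] ns0.
exists (fun t => s' t *: c' (s t)); split.
  by move=> t; exact: has_deriv_comp.
by apply: ndiffZ => //; exact: IH.
Qed.

Lemma ndiff_pair E F n (c : R^o -> E) (d : R^o -> F) :
  ndiff n c -> ndiff n d -> ndiff (E := (E * F)%type) n (fun t => (c t, d t)).
Proof.
elim: n c d => //= n IH c d [c' [cc' nc]] [d' [dd' nd]].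
exists (fun t => (c' t, d' t)); split; last exact: IH.
by move=> t; exact: has_deriv_pair.
Qed.

Lemma ndiff_linear E F n (f : {linear E -> F}) (c : R^o -> E) :
  continuous f -> ndiff n c -> ndiff n (f \o c).
Proof.
move=> cf; elim: n c => //= n IH c [c' [cc' nc]].
exists (f \o c'); split; last exact: IH.
by move=> t; exact: has_deriv_linear.
Qed.

Lemma hausdorff_pair E F : hausdorff_space E -> hausdorff_space F ->
  hausdorff_space (E * F)%type.
Proof.
move=> hE hF [x y] [x' y'] xy; congr (_, _).
  apply: hE => A B xA xB.
  have [||[a b] [/= [? _] [? _]]] := xy (A `*` setT) (B `*` setT).
  - by exists (A, setT) => //=; split => //; exact: filterT.
  - by exists (B, setT) => //=; split => //; exact: filterT.
  by exists a.
apply: hF => A B xA xB.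
have [||[a b] [/= [_ ?] [_ ?]]] := xy (setT `*` A) (setT `*` B).
- by exists (setT, A) => //=; split => //; exact: filterT.
- by exists (setT, B) => //=; split => //; exact: filterT.
by exists b.
Qed.

Lemma hausdorff_real : hausdorff_space R^o.
Proof. exact: norm_hausdorff. Qed.

Lemma smooth_curveP E (c : R^o -> E) : hausdorff_space E ->
  smooth_curve c <-> forall n, ndiff n c.
Proof.
move=> hE; split=> [sc n|nc n].
  have H k : ndiff n (iter k (@velocity R E) c).
    elim: n k => // n IH k; exists (iter k.+1 (@velocity R E) c).
    split; last exact: IH.
    move=> t; have [l cl] := sc k t.
    by rewrite iterS (velocity_eq hE cl).
  exact: (H 0%N).
suff H k : ndiff k (iter n (@velocity R E) c).
  by move=> t; have [d [cd _]] := H 1%N; exists (d t); exact: cd.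
elim: n k => [k|n IH k]; first exact: nc.
have [d [cd nd]] := IH k.+1.
rewrite iterS (_ : velocity _ = d)//; apply/funext => t.
exact: velocity_eq.
Qed.

Lemma smooth_has_deriv E (c : R^o -> E) : hausdorff_space E ->
  smooth_curve c -> forall t, has_deriv c t (velocity c t).
Proof.
by move=> hE sc t; have [l cl] := sc 0%N t; rewrite (velocity_eq hE cl).
Qed.

Lemma smooth_velocity E (c : R^o -> E) :
  smooth_curve c -> smooth_curve (velocity c).
Proof. by move=> sc n t; have := sc n.+1 t; rewrite iterSr. Qed.

Lemma smooth_iter_velocity E (c : R^o -> E) n :
  smooth_curve c -> smooth_curve (iter n (@velocity R E) c).
Proof. by move=> sc; elim: n => // n; exact: smooth_velocity. Qed.

(** The functions met below come in families closed under differentiation. *)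
Lemma smooth_curve_coind E (P : (R^o -> E) -> Prop) : hausdorff_space E ->
  (forall c, P c -> exists d, P d /\ forall t, has_deriv c t (d t)) ->
  forall c, P c -> smooth_curve c.
Proof.
move=> hE step c Pc; apply/(smooth_curveP _ hE) => n.
elim: n c Pc => // n IH c /step[d [Pd cd]].
by exists d; split => //; exact: IH.
Qed.

Lemma smooth_cst E (x : E) : hausdorff_space E -> smooth_curve (fun=> x : E).
Proof. by move=> hE; apply/(smooth_curveP _ hE) => n; exact: ndiff_cst. Qed.

Lemma smooth_id : smooth_curve (id : R^o -> R^o).
Proof. by apply/(smooth_curveP _ hausdorff_real) => n; exact: ndiff_id. Qed.

Lemma smoothD E (c d : R^o -> E) : hausdorff_space E ->
  smooth_curve c -> smooth_curve d -> smooth_curve (fun t => c t + d t).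
Proof.
move=> hE /(smooth_curveP _ hE) nc /(smooth_curveP _ hE) nd.
by apply/(smooth_curveP _ hE) => n; exact: ndiffD.
Qed.

Lemma smoothZ E (s : R^o -> R^o) (c : R^o -> E) : hausdorff_space E ->
  smooth_curve s -> smooth_curve c -> smooth_curve (fun t => s t *: c t).
Proof.
move=> hE /(smooth_curveP _ hausdorff_real) ns /(smooth_curveP _ hE) nc.
by apply/(smooth_curveP _ hE) => n; exact: ndiffZ.
Qed.

Lemma smoothM (s u : R^o -> R^o) :
  smooth_curve s -> smooth_curve u -> smooth_curve (fun t => s t * u t : R^o).
Proof. exact: smoothZ hausdorff_real. Qed.

Lemma smooth_comp E (s : R^o -> R^o) (c : R^o -> E) : hausdorff_space E ->
  smooth_curve s -> smooth_curve c -> smooth_curve (fun t => c (s t)).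
Proof.
move=> hE /(smooth_curveP _ hausdorff_real) ns /(smooth_curveP _ hE) nc.
by apply/(smooth_curveP _ hE) => n; exact: ndiff_comp.
Qed.

Lemma smooth_pair E F (c : R^o -> E) (d : R^o -> F) :
  hausdorff_space E -> hausdorff_space F ->
  smooth_curve c -> smooth_curve d ->
  smooth_curve (E := (E * F)%type) (fun t => (c t, d t)).
Proof.
move=> hE hF /(smooth_curveP _ hE) nc /(smooth_curveP _ hF) nd.
by apply/(smooth_curveP _ (hausdorff_pair hE hF)) => n; exact: ndiff_pair.
Qed.

Lemma smooth_linear E F (f : {linear E -> F}) (c : R^o -> E) :
  hausdorff_space E -> hausdorff_space F -> continuous f ->
  smooth_curve c -> smooth_curve (f \o c).
Proof.
move=> hE hF cf /(smooth_curveP _ hE) nc.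
by apply/(smooth_curveP _ hF) => n; exact: ndiff_linear.
Qed.

Lemma smooth_affine (a b : R) : smooth_curve (fun t : R^o => a + b * t : R^o).
Proof.
apply: smoothD hausdorff_real _ _; first exact: smooth_cst hausdorff_real.
by apply: smoothM; [exact: smooth_cst hausdorff_real|exact: smooth_id].
Qed.

Lemma smooth_continuous E (c : R^o -> E) : hausdorff_space E ->
  smooth_curve c -> continuous c.
Proof.
by move=> hE sc t; apply: has_deriv_continuous; exact: smooth_has_deriv.
Qed.

(** The velocity is a default value where the limit does not exist, so smoothness
    of one of the two germs is needed to transport higher derivatives. *)
Lemma near_iter_velocity E (c d : R^o -> E) (t : R^o) n : hausdorff_space E ->
  smooth_curve d -> (\forall s \near t, c s = d s) ->
  \forall s \near t,
    iter n (@velocity R E) c s = iter n (@velocity R E) d s.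
Proof.
move=> hE sd; elim: n => // n IH /IH /near_join; apply: filterS => s cds.
rewrite !iterS; apply: velocity_eq => //; apply: near_deriv.
  by apply: filterS cds => u ->.
exact: (smooth_has_deriv hE (smooth_iter_velocity n sd)).
Qed.

Lemma smooth_local E (c : R^o -> E) : hausdorff_space E ->
  (forall t : R^o, exists2 d, smooth_curve d & \forall s \near t, c s = d s) ->
  smooth_curve c.
Proof.
move=> hE loc n t; have [d sd cd] := loc t.
exists (iter n.+1 (@velocity R E) d t).
have dd : has_deriv (iter n (@velocity R E) d) t (iter n.+1 (@velocity R E) d t).
  exact: (smooth_has_deriv hE (smooth_iter_velocity n sd)).
have cdn : \forall s \near t,
    iter n (@velocity R E) d s = iter n (@velocity R E) c s.
  by apply: filterS (near_iter_velocity n hE sd cd) => s ->.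
exact: near_deriv cdn dd.
Qed.

End CurveDerivatives.

(** * Smooth curves through fast sequences *)

Section SpecialCurve.
Context {R : realType}.

Lemma is_derive_has_deriv (c : R -> R) (t l : R) :
  is_derive t 1 c l -> has_deriv (c : R^o -> R^o) t l.
Proof.
move=> [dc <-]; rewrite /has_deriv /derive.
rewrite (_ : slope _ t 1 = fun h => h^-1 *: ((c \o shift t) (h *: 1) - c t)).
  exact: dc.
by apply/funext => h; rewrite slopeE /shift/= /GRing.scale/= mulr1 [t + h]addrC.
Qed.

Lemma has_deriv_is_derive (c : R -> R) (t l : R) :
  has_deriv (c : R^o -> R^o) t l -> is_derive t (1 : R) c l.
Proof.
move=> ct.
have {}ct : h^-1 *: ((c \o shift t) (h *: 1) - c t) @[h --> (0 : R)^'] --> l.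
  rewrite (_ : (fun h => _) = slope (c : R^o -> R^o) t 1) //.
  by apply/funext => h; rewrite slopeE /shift/= /GRing.scale/= mulr1 [t + h]addrC.
split; last exact: cvg_lim ct.
by apply/cvg_ex; exists l.
Qed.

Lemma has_deriv_quadratic (c : R^o -> R^o) (t l : R^o) (C : R) :
  (\forall h \near (0 : R), `|c (t + h) - c t - h * l| <= C * h ^+ 2) ->
  has_deriv c t l.
Proof.
move=> cC; apply/(@cvgrPdist_le _ R^o) => e e0.
have C0 : 0 < `|C| + 1 by rewrite ltr_wpDl.
near=> h.
have h0 : h != 0 by near: h; exact: nbhs_dnbhs_neq.
have hC : `|c (t + h) - c t - h * l| <= C * h ^+ 2.
  by near: h; exact: nbhs_dnbhs.
have he : `|h| < e / (`|C| + 1).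
  by near: h; apply: dnbhs0_lt; exact: divr_gt0.
rewrite slopeE -[_ *: _]/(_ * _).
have -> : l - h^-1 * (c (t + h) - c t) = - (h^-1 * (c (t + h) - c t - h * l)).
  by field.
rewrite normrN normrM normfV ler_pdivrMl ?normr_gt0//.
apply: (le_trans hC); rewrite -(real_normK (num_real h)) expr2 mulrCA mulrA.
rewrite -mulrA; apply: ler_wpM2l => //.
rewrite ltr_pdivlMr// in he.
apply: le_trans (ltW he); rewrite mulrC; apply: ler_wpM2l => //.
by rewrite (le_trans (ler_norm C))// lerDl.
Unshelve. all: by end_near. Qed.

(** ** The flat function and a plateau *)

(** Products of [exp(-1/x)] with polynomials in [1/x]: a family closed under
    differentiation, all members of which vanish to infinite order at [0]. *)
Definition flat (p : {poly R}) (x : R) : R :=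
  if 0 < x then p.[x^-1] * expR (- x^-1) else 0.

Lemma poly_le_exp (p : {poly R}) :
  exists C : R, forall u, 0 <= u -> `|p.[u]| <= C * expR u.
Proof.
exists (\sum_(i < size p) `|p`_i| * i`!%:R) => u u0.
rewrite horner_coef (le_trans (ler_norm_sum _ _ _))// mulr_suml.
apply: ler_sum => i _; rewrite normrM -mulrA; apply: ler_wpM2l => //.
rewrite ger0_norm ?exprn_ge0//.
have f0 : (0 : R) < (i : nat)`!%:R by rewrite ltr0n fact_gt0.
rewrite -ler_pdivrMl// mulrC.
case: (i : nat) => [|n].
  by rewrite expr0 fact0 divr1 (le_trans _ (expR_ge1Dx u))// lerDl.
by apply: le_trans (expR_ge1Dxn n u0); rewrite lerDr.
Qed.

Lemma has_deriv_flat p x :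
  has_deriv (flat p : R^o -> R^o) x (flat ('X^2 * (p - p^`())) x).
Proof.
have [x0|x0|x0] := ltgtP x 0.
- rewrite /flat ltNge (ltW x0)/=.
  apply: (@near_deriv _ _ (fun=> 0)); last exact: has_deriv_cst.
  have : \forall s \near (x : R), s < 0 by exact: lt_nbhsl.
  by apply: filterS => s s0; rewrite ltNge (ltW s0).
- rewrite {2}/flat x0; apply: (@near_deriv _ _ (fun x => p.[x^-1] * expR (- x^-1))).
    have : \forall s \near (x : R), 0 < s by exact: lt_nbhsr.
    by apply: filterS => s s0; rewrite /flat s0.
  apply: is_derive_has_deriv.
  have d1 : is_derive x 1 (fun x : R => x^-1) (- x ^- 2 *: (1 : R)).
    by apply: is_deriveV => //; rewrite gt_eqF.
  have d2 : is_derive (x^-1) 1 (fun u : R => p.[u] * expR (- u))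
      (p.[x^-1] *: (- expR (- x^-1)) + expR (- x^-1) *: p^`().[x^-1]).
    have de : is_derive (x^-1) 1 (fun u : R => expR (- u)) (- expR (- x^-1)).
      have dN : is_derive (x^-1) 1 (fun u : R => - u) (- 1 : R).
        exact: is_deriveNid.
      have := @is_derive1_comp _ expR _ _ _ _ (is_derive_expR (- x^-1)) dN.
      by rewrite mulrN1.
    exact: (@is_deriveM _ _ _ _ _ _ _ _ (is_derive_poly p (x^-1)) de).
  have := @is_derive1_comp _ (fun u : R => p.[u] * expR (- u)) _ _ _ _ d2 d1.
  move=> /is_derive_eq; apply.
  rewrite hornerM hornerXn hornerD hornerN /GRing.scale/=.
  by rewrite exprVn; ring.
- rewrite x0 {2}/flat ltxx.
  have [C pC] := poly_le_exp ('X^2 * p).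
  apply: (@has_deriv_quadratic _ _ _ C); near=> h.
  rewrite add0r /flat ltxx mulr0 !subr0; case: ifPn => h0; last first.
    rewrite normr0 mulr_ge0 ?sqr_ge0//.
    by have := pC 0 (lexx 0); rewrite expR0 mulr1; exact: le_trans.
  rewrite expRN normrM normfV (ger0_norm (expR_ge0 _)) ler_pdivrMr ?expR_gt0//.
  have hv : 0 <= h^-1 by rewrite invr_ge0 ltW.
  have := pC _ hv; rewrite hornerM hornerXn normrM (ger0_norm (exprn_ge0 _ hv)).
  rewrite exprVn ler_pdivrMl ?exprn_gt0//.
  by rewrite mulrA [h ^+ 2 * C]mulrC.
Unshelve. all: by end_near. Qed.

Lemma smooth_flat p : smooth_curve (flat p : R^o -> R^o).
Proof.
pose P (c : R^o -> R^o) := exists p, c = flat p.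
apply: (smooth_curve_coind hausdorff_real (P := P)); last by exists p.
move=> _ [q ->]; exists (flat ('X^2 * (q - q^`()))); split; first by eexists.
exact: has_deriv_flat.
Qed.

(** With [f] the flat function [exp(-1/x)], the composite
    [e f(1 - e f(x^2 - 1))] is constant where the inner [f] vanishes, and
    vanishes where the inner [f] is at least [1/e]. *)
Lemma plateau : exists2 phi : R^o -> R^o, smooth_curve phi &
  (forall x : R, `|x| <= 1 -> phi x = 1) /\ (forall x : R, 2 < `|x| -> phi x = 0).
Proof.
pose f := flat 1; pose e : R := expR 1.
have fE y : 0 < y -> f y = expR (- y^-1).
  by move=> y0; rewrite /f /flat y0 hornerC mul1r.
have f0 y : y <= 0 -> f y = 0 by move=> y0; rewrite /f /flat ltNge y0.
have sf : smooth_curve (f : R^o -> R^o) by exact: smooth_flat.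
exists (fun x => e * f (1 + (- e) * f (-1 + x * x))); last first.
  split=> x x1.
    rewrite (f0 (-1 + _)) ?mulr0 ?addr0 ?fE// ?invr1 -?expRD ?subrr ?expR0//.
    by rewrite addrC subr_le0 -expr2 -(real_normK (num_real x)) expr_le1.
  rewrite (f0 (1 + _)) ?mulr0// mulNr subr_le0.
  have x2 : 1 <= -1 + x * x.
    rewrite -expr2 -(real_normK (num_real x)).
    have : 2 ^+ 2 <= `|x| ^+ 2 by rewrite ler_sqr ?nnegrE// ltW.
    by lra.
  rewrite fE ?(lt_le_trans ltr01)// -expRD -[X in X <= _]expR0 ler_expR.
  by rewrite subr_ge0 invf_le1// (lt_le_trans ltr01).
have scst a : smooth_curve (fun=> a : R^o) by exact: smooth_cst hausdorff_real.
apply: smoothM => //.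
apply: (@smooth_comp _ _ (fun x => 1 + (- e) * f (-1 + x * x)) f
  hausdorff_real) => //.
apply: smoothD hausdorff_real _ _ => //; apply: smoothM => //.
apply: (@smooth_comp _ _ (fun x => -1 + x * x) f hausdorff_real) => //.
apply: smoothD hausdorff_real _ _ => //; apply: smoothM => //; exact: smooth_id.
Qed.

End SpecialCurve.

(** ** Sums of shrinking plateaus *)

Section ShrinkingSums.
Context {R : realType}.

(** Plateaus of width comparable to [2^-k] are centred at the knots [2^-k], with
    disjoint supports.  Heights bounded by [2^-(k^2)] beat every power of the
    width, so that the sum of the plateaus is smooth at [0] too. *)
Definition knot (k : nat) : R := 2^-1 ^+ k.

Lemma knot_gt0 k : 0 < knot k. Proof. by rewrite exprn_gt0// invr_gt0. Qed.

Lemma knotK k : 2 ^+ k * knot k = 1.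
Proof. by rewrite /knot exprVn divff// expf_neq0. Qed.

Lemma sum_knot n : \sum_(k < n) knot k <= 2.
Proof.
suff -> : \sum_(k < n) knot k = 2 - 2 * knot n.
  by rewrite lerBlDr lerDl mulr_ge0// ltW// knot_gt0.
elim: n => [|n IH]; first by rewrite big_ord0 /knot expr0; lra.
by rewrite big_ord_recr/= IH /knot exprS; lra.
Qed.

(** Because [k m <= k^2] or [k m <= m^2]. *)
Lemma fast_decay (m k : nat) : 2^-1 ^+ (k ^ 2) * (2 ^+ k) ^+ m <= 2 ^+ (m ^ 2) :> R.
Proof.
rewrite exprVn mulrC ler_pdivrMr ?exprn_gt0// -exprM -exprD.
rewrite ler_eXn2l ?ltr1n//.
rewrite -!mulnn; case: (leqP k m) => km.
  by rewrite (leq_trans _ (leq_addr _ _))// leq_mul2r km orbT.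
by rewrite (leq_trans _ (leq_addl _ _))// leq_mul2l (ltnW km) orbT.
Qed.

Lemma iter_velocity_vanish (phi : R^o -> R^o) n :
  (forall x : R, 2 < `|x| -> phi x = 0) ->
  forall x : R, 2 < `|x| -> iter n (@velocity R R^o) phi x = 0.
Proof.
move=> phi0; elim: n => // n IH x x2; rewrite iterS.
apply: (velocity_eq hausdorff_real).
apply: (@near_deriv _ _ (fun=> 0)); last exact: has_deriv_cst.
have : \forall s \near (x : R), 2 < `|s|.
  exact: (@cvgr_norm_gt R R^o _ _ _ id x cvg_id).
by apply: filterS => s s2; rewrite IH.
Qed.

Lemma iter_velocity_bounded (phi : R^o -> R^o) n : smooth_curve phi ->
  (forall x : R, 2 < `|x| -> phi x = 0) ->
  exists2 C : R, 0 < C & forall x : R, `|iter n (@velocity R R^o) phi x| <= C.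
Proof.
move=> sphi phi0; set f := iter _ _ _.
have cf : continuous f.
  exact: smooth_continuous hausdorff_real (smooth_iter_velocity n sphi).
have [||c _ cm] := @EVT_max R (fun x : R => `|f x|) (- 2) 2.
- by lra.
- apply: continuous_subspaceT => x; apply: (@cvg_norm R R^o); exact: cf.
exists (`|f c| + 1) => [|x]; first by rewrite ltr_wpDl.
rewrite ler_wpDr//; have [x2|x2] := leP `|x| 2; last first.
  by rewrite /f iter_velocity_vanish// normr0.
by apply: cm; rewrite in_itv/= -ler_norml.
Qed.

Lemma has_deriv_sum n (c d : nat -> R^o -> R^o) (t : R^o) :
  (forall k, (k < n)%N -> has_deriv (c k) t (d k t)) ->
  has_deriv (fun t => \sum_(k < n) c k t : R^o) t (\sum_(k < n) d k t).
Proof.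
elim: n => [|n IH] cd.
  rewrite big_ord0 (_ : (fun _ => _) = fun=> 0); first exact: has_deriv_cst.
  by apply/funext => s; rewrite big_ord0.
rewrite big_ord_recr/= (_ : (fun _ => _) = (fun t => \sum_(k < n) c k t + c n t)).
  apply: has_derivD; last exact: cd.
  by apply: IH => k kn; apply: cd; exact: ltnW.
by apply/funext => s; rewrite big_ord_recr.
Qed.

Section Sum.
Variables (phi : R^o -> R^o) (a : nat -> R).
Hypotheses (sphi : smooth_curve phi) (phi0 : forall x : R, 2 < `|x| -> phi x = 0).
Hypothesis a_fast : forall k, `|a k| <= 2^-1 ^+ (k ^ 2).

Let s k : R := 8 * 2 ^+ k.

(** The [n]-th derivative of the plateau at the [k]-th knot. *)
Let term n k (t : R) : R :=
  a k * s k ^+ n * iter n (@velocity R R^o) phi (s k * (t - knot k)).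

Let s_gt0 k : 0 < s k. Proof. by rewrite mulr_gt0// exprn_gt0. Qed.

Let term_vanish n k t : 2 < `|s k * (t - knot k)| -> term n k t = 0.
Proof. by move=> st; rewrite /term iter_velocity_vanish ?mulr0. Qed.

Let sE k t : s k * (t - knot k) = 8 * (2 ^+ k * t - 1).
Proof. by rewrite /s -mulrA mulrBr knotK. Qed.

Let term_far n k N (t : R) : 0 < t -> 2 / t < N%:R -> (N <= k)%N -> term n k t = 0.
Proof.
move=> t0 tN Nk; apply: term_vanish; rewrite sE.
have : 2 < 2 ^+ k * t.
  rewrite -ltr_pdivrMr//; apply: (lt_le_trans tN).
  rewrite -natrX ler_nat (leq_trans Nk)// ltnW// ltn_expl//.
by move=> k2; rewrite ger0_norm; lra.
Qed.

(* the plateaus of index at least N t vanish at t *)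
Let N (t : R) : nat := (Num.truncn (2 / t)).+1.

Let D n (t : R^o) : R^o := if 0 < t then \sum_(k < N t) term n k t else 0.

Let NP t : 2 / t < (N t)%:R. Proof. exact: truncnS_gt. Qed.

Let D_fin n (t : R) m : 0 < t -> 2 / t < m%:R -> D n t = \sum_(k < m) term n k t.
Proof.
move=> t0 tm; rewrite /D t0.
have wlg p q : 2 / t < p%:R -> 2 / t < q%:R -> (p <= q)%N ->
    \sum_(k < p) term n k t = \sum_(k < q) term n k t.
  move=> tp tq pq; rewrite -!(big_mkord xpredT (fun k => term n k t)).
  rewrite (big_cat_nat (leq0n p) pq)/= [X in _ = _ + X]big_nat_cond.
  rewrite [X in _ = _ + X]big1 ?addr0// => k.
  by rewrite andbT => /andP[pk _]; exact: term_far tp pk.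
by have [/wlg->//|/ltnW /wlg <-//] := leqP (N t) m.
Qed.

Let term_deriv n k (t : R^o) :
  has_deriv (term n k : R^o -> R^o) t (term n.+1 k t).
Proof.
pose u (t : R^o) : R^o := - (s k * knot k) + s k * t.
have du : has_deriv u t (s k) by exact: has_deriv_affine.
have dphi := smooth_has_deriv hausdorff_real (smooth_iter_velocity n sphi) (t := u t).
have := has_derivZ (has_deriv_cst (a k * s k ^+ n : R^o) t) (has_deriv_comp du dphi).
rewrite scale0r addr0 /u.
rewrite (_ : _ *: _ = term n.+1 k t); last first.
  rewrite /term iterS -/(iter n _ phi) mulrBr [s k * t - _]addrC exprS.
  by rewrite /GRing.scale/=; ring.
rewrite (_ : (fun _ => _) = term n k)//; apply/funext => x.
by rewrite /term mulrBr [s k * x - _]addrC.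
Qed.

Let D_near0 n : exists C, forall h, `|D n h| <= C * h ^+ 2.
Proof.
have [M M0 phiM] := iter_velocity_bounded n sphi phi0.
pose K := 2 ^+ ((n + 3) ^ 2) * 8 ^+ n * M.
have K0 : 0 <= K by rewrite !mulr_ge0// ?exprn_ge0// ltW.
exists (8 * K) => h; rewrite /D; case: ifPn => h0; last first.
  by rewrite normr0 mulr_ge0 ?sqr_ge0// mulr_ge0.
apply: (le_trans (ler_norm_sum _ _ _)).
apply: (@le_trans _ _ (\sum_(k < N h) (4 * K * h ^+ 2) * knot k)); last first.
  rewrite -mulr_sumr (_ : 8 * K * h ^+ 2 = 4 * K * h ^+ 2 * 2); last by ring.
  by rewrite ler_wpM2l ?sum_knot// mulr_ge0 ?sqr_ge0// mulr_ge0.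
apply: ler_sum => k _; have k0 := knot_gt0 k.
have [far|close] := ltP 2 `|s k * (h - knot k)|.
  by rewrite term_vanish// normr0 !mulr_ge0// ltW.
have kh : knot k <= 2 * h.
  have : - 2 <= 8 * (2 ^+ k * h - 1) by rewrite -sE; case/ler_normlP: close; lra.
  move=> H; have : 3 / 4 <= 2 ^+ k * h by lra.
  move=> /(ler_wpM2r (ltW k0)); rewrite [X in _ <= X]mulrAC knotK mul1r => H2; lra.
rewrite /term normrM.
have a3 : `|a k * s k ^+ n| <= 2 ^+ ((n + 3) ^ 2) * 8 ^+ n * knot k ^+ 3.
  have aP : `|a k| * (2 ^+ k) ^+ (n + 3) <= 2 ^+ ((n + 3) ^ 2).
    apply: le_trans (fast_decay (n + 3) k).
    by apply: ler_wpM2r (a_fast k); rewrite !exprn_ge0.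
  rewrite normrM (ger0_norm (exprn_ge0 _ (ltW (s_gt0 k)))) /s exprMn.
  have -> : (2 ^+ k) ^+ n = (2 ^+ k) ^+ (n + 3) * knot k ^+ 3 :> R.
    by rewrite exprD -mulrA -exprMn knotK expr1n mulr1.
  rewrite (_ : _ * _ = `|a k| * (2 ^+ k) ^+ (n + 3) * (8 ^+ n * knot k ^+ 3));
    last by ring.
  rewrite -[X in _ <= X]mulrA; apply: ler_wpM2r => //.
  by rewrite mulr_ge0// exprn_ge0// ltW.
apply: le_trans (ler_pM _ _ a3 (phiM _)) _ => //.
rewrite (_ : _ * _ * M = K * knot k ^+ 2 * knot k); last by rewrite /K; ring.
apply: ler_wpM2r; first exact: ltW.
rewrite (_ : 4 * K * h ^+ 2 = K * (2 * h) ^+ 2); last by ring.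
by apply: ler_wpM2l => //; rewrite ler_sqr ?nnegrE// ltW// mulr_gt0.
Qed.

Let D_deriv n (t : R^o) : has_deriv (D n) t (D n.+1 t).
Proof.
have [t0|t0|t0] := ltgtP t 0.
- rewrite {2}/D ltNge (ltW t0)/=.
  apply: (@near_deriv _ _ (fun=> 0)); last exact: has_deriv_cst.
  have : \forall s \near (t : R), s < 0 by exact: lt_nbhsl.
  by apply: filterS => r r0; rewrite /D ltNge (ltW r0).
- have t2 : 0 < t / 2 by rewrite divr_gt0.
  have tt2 : t / 2 < t by lra.
  pose m := N (t / 2).
  have near_m r : t / 2 < r -> 0 < r /\ 2 / r < m%:R.
    move=> tr; have r0 := lt_trans t2 tr; split => //.
    by apply: lt_trans (NP (t / 2)); rewrite ltr_pM2l// ltf_pV2.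
  rewrite (@D_fin _ _ m t0 (near_m _ tt2).2).
  apply: (@near_deriv _ _ (fun t => \sum_(k < m) term n k t)).
    have : \forall s \near (t : R), t / 2 < s by exact: lt_nbhsr.
    by apply: filterS => r /near_m[r0 rm]; rewrite (D_fin n r0 rm).
  by apply: has_deriv_sum => k _; exact: term_deriv.
- rewrite t0 {2}/D ltxx; have [C DC] := D_near0 n.
  apply: (@has_deriv_quadratic _ _ _ _ C); near=> h.
  by rewrite add0r mulr0 {2}/D ltxx !subr0.
Unshelve. all: by end_near. Qed.

Lemma shrinking_sum : exists2 sig : R^o -> R^o, smooth_curve sig &
  sig 0 = 0 /\ forall k t, `|t - knot k| <= knot k / 4 ->
    sig t = a k * phi (8 * 2 ^+ k * (t - knot k)).
Proof.
exists (D 0%N).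
  apply: (smooth_curve_coind hausdorff_real (P := fun c => exists n, c = D n)).
    move=> _ [n ->]; exists (D n.+1); split; first by exists n.+1.
    exact: D_deriv.
  by exists 0%N.
split=> [|k t]; first by rewrite /D ltxx.
have k0 := knot_gt0 k; rewrite ler_distl => /andP[tl tu].
have t0 : 0 < t by lra.
have kt : 3 / 4 <= 2 ^+ k * t <= 5 / 4.
  have := knotK k; have : 0 < 2 ^+ k :> R by rewrite exprn_gt0.
  move: (2 ^+ k) => x x0 xk.
  have : x * (knot k - knot k / 4) <= x * t by apply: ler_wpM2l => //; exact: ltW.
  have : x * t <= x * (knot k + knot k / 4) by apply: ler_wpM2l => //; exact: ltW.
  rewrite mulrBr mulrDr mulrA xk => *; apply/andP; split; lra.
pose m := (maxn (N t) k.+1).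
have tm : 2 / t < m%:R.
  by apply: lt_le_trans (NP t) _; rewrite ler_nat leq_maxl.
have km : (k < m)%N by rewrite leq_maxr.
rewrite (D_fin 0 t0 tm) (bigD1 (Ordinal km))//= big1 ?addr0.
  by rewrite /term expr0 mulr1.
move=> [j jm] /=; rewrite -val_eqE/= => jk; apply: term_vanish; rewrite sE.
case/andP: kt => k1 k2; rewrite neq_ltn in jk.
have two0 i : 0 < 2 ^+ i :> R by rewrite exprn_gt0.
case/orP: jk => jk.
  have : 2 * (2 ^+ j * t) <= 2 ^+ k * t.
    by rewrite mulrA -exprS ler_wpM2r ?(ltW t0)// ler_eXn2l// ltr1n.
  move=> H; rewrite ltr0_norm; lra.
have : 2 * (2 ^+ k * t) <= 2 ^+ j * t.
  by rewrite mulrA -exprS ler_wpM2r ?(ltW t0)// ler_eXn2l// ltr1n.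
by move=> H; rewrite gtr0_norm; lra.
Qed.

End Sum.

(** The special curve lemma of Kriegl and Michor on the line.  The values [a] and
    the slopes [e] are realized by shrinking copies of a plateau [phi] and of
    [u phi(u)]. *)
Lemma special_curve (a e : nat -> R) :
  (forall k, `|a k| <= 2^-1 ^+ (k ^ 2)) -> (forall k, `|e k| <= 2^-1 ^+ (k ^ 2)) ->
  exists2 sig : R^o -> R^o, smooth_curve sig &
    sig 0 = 0 /\ forall k t, `|t - knot k| <= knot k / 8 ->
      sig t = a k + e k * (t - knot k).
Proof.
move=> ha he; have [phi sphi [phi1 phi0]] := @plateau R.
have schi : smooth_curve (fun u : R^o => u * phi u : R^o).
  by apply: smoothM => //; exact: smooth_id.
have chi0 x : 2 < `|x| -> x * phi x = 0 by move=> /phi0 ->; rewrite mulr0.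
have s0 k : 0 < 8 * 2 ^+ k :> R by rewrite mulr_gt0// exprn_gt0.
have he' k : `|e k / (8 * 2 ^+ k)| <= 2^-1 ^+ (k ^ 2).
  apply: le_trans (he k); rewrite normrM normfV (gtr0_norm (s0 k)).
  rewrite ler_pdivrMr// ler_peMr// mulr_ege1// ?ler1n//.
  by rewrite exprn_ege1// ler1n.
have [A sA [A0 AE]] := shrinking_sum sphi phi0 ha.
have [B sB [B0 BE]] := shrinking_sum schi chi0 he'.
exists (fun t => A t + B t); first exact: smoothD hausdorff_real sA sB.
split=> [|k t tk]; first by rewrite A0 B0 addr0.
have k0 := knot_gt0 k.
have tk4 : `|t - knot k| <= knot k / 4 by apply: le_trans tk _; lra.
rewrite (AE k t tk4) (BE k t tk4).
rewrite phi1 ?mulr1//; last first.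
  rewrite normrM (gtr0_norm (s0 k)) -ler_pdivlMl// mulr1.
  apply: (le_trans tk); rewrite invfM [knot k / 8]mulrC.
  by rewrite ler_pM2l ?invr_gt0// /knot exprVn.
by congr (_ + _); field; rewrite expf_neq0.
Qed.

End ShrinkingSums.

(** * Taylor expansions in one variable *)

Section MeanValue.
Context {R : realType}.

Lemma mean_value_bound (g dg : R^o -> R^o) (u K : R) :
  (forall v, has_deriv g v (dg v)) ->
  (forall v : R, `|v| <= `|u| -> `|dg v| <= K) ->
  `|g u - g 0| <= K * `|u|.
Proof.
move=> gd dK.
have cg : continuous (g : R -> R).
  by move=> x; exact: has_deriv_continuous (gd x).
have D x : is_derive (x : R) 1 (g : R -> R) (dg x) by exact: has_deriv_is_derive.
have [u0|u0] := leP 0 u.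
  have [v vu ->] := @MVT_segment R g dg 0 u u0 (fun x _ => D x)
    (@continuous_subspaceT _ _ _ _ cg).
  rewrite subr0 normrM; apply: ler_wpM2r => //; apply: dK.
  by move: vu; rewrite in_itv/= => /andP[v0 vu]; rewrite !ger0_norm.
have [v vu E] := @MVT_segment R g dg u 0 (ltW u0) (fun x _ => D x)
  (@continuous_subspaceT _ _ _ _ cg).
rewrite distrC E sub0r normrM normrN; apply: ler_wpM2r => //; apply: dK.
by move: vu; rewrite in_itv/= => /andP[v0 vu]; rewrite !ler0_norm ?lerN2// ltW.
Qed.

Definition taylor (c : R^o -> R^o) (m : nat) : {poly R} :=
  \poly_(q < m) (iter q (@velocity R R^o) c 0 / q`!%:R).

Lemma taylorS (h : R^o -> R^o) m (t : R) : (taylor h m.+1).[t] =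
  (taylor h m).[t] + iter m (@velocity R R^o) h 0 / m`!%:R * t ^+ m.
Proof. by rewrite /taylor !horner_poly big_ord_recr. Qed.

Lemma deriv_taylor (h : R^o -> R^o) m : (taylor h m.+1)^`() = taylor (velocity h) m.
Proof.
apply/polyP => q; rewrite coef_deriv !coef_poly ltnS -iterSr; case: ifP => _.
  by rewrite -[LHS]mulr_natr factS mulnC natrM invfM mulrA divfK ?pnatr_eq0.
by rewrite mul0rn.
Qed.

(** The difference of a curve and its Taylor polynomial has as derivative the same
    difference for the velocity, one order lower: integrate by the mean value
    bound. *)
Lemma taylor_bound (c : R^o -> R^o) (m : nat) (K r : R) : smooth_curve c ->
  (forall u : R, `|u| <= r -> `|iter m (@velocity R R^o) c u| <= K) ->
  forall u : R, `|u| <= r -> `|c u - (taylor c m).[u]| <= K * `|u| ^+ m.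
Proof.
elim: m c => [|m IH] c sc cK u ur.
  rewrite /taylor poly_def big_ord0 horner0 subr0 expr0 mulr1; exact: cK.
pose g (u : R^o) : R^o := c u - (taylor c m.+1).[u].
have g0 : g 0 = 0.
  by rewrite /g horner_coef0 coef_poly/= fact0 divr1 subrr.
have dg v : has_deriv g v (velocity c v - (taylor (velocity c) m).[v]).
  have dc := has_deriv_is_derive (smooth_has_deriv hausdorff_real sc (t := v)).
  by rewrite -deriv_taylor; apply: is_derive_has_deriv.
rewrite -/(g u) -[g u]subr0 -g0 exprSr mulrA.
apply: (mean_value_bound dg) => v vu.
have vr : `|v| <= r by exact: le_trans vu ur.
apply: le_trans (IH _ (smooth_velocity sc) _ v vr) _.
  by move=> w wr; rewrite -iterSr; exact: cK.
apply: ler_wpM2l; last by apply: lerXn2r => //; rewrite nnegrE.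
exact: le_trans (cK u ur).
Qed.

Lemma iter_velocity_affine (c : R^o -> R^o) (x y : R) n (u : R) :
  smooth_curve c ->
  iter n (@velocity R R^o) (fun u => c (x + y * u)) u =
  y ^+ n * iter n (@velocity R R^o) c (x + y * u).
Proof.
move=> sc; elim: n u => [|n IH] u; first by rewrite expr0 mul1r.
rewrite !iterS (_ : iter n _ _ =
  (fun u : R^o => y ^+ n *: iter n (@velocity R R^o) c (x + y * u))); last first.
  by apply/funext => v; exact: IH.
apply: (velocity_eq hausdorff_real).
have dc := smooth_has_deriv hausdorff_real (smooth_iter_velocity n sc)
  (t := x + y * u).
have := has_derivZ (has_deriv_cst (y ^+ n : R^o) u)
  (has_deriv_comp (@has_deriv_affine R x y u) dc).
by rewrite scale0r addr0 /GRing.scale/= mulrA -exprSr.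
Qed.

(** [f t = O(t^m)] as [t] tends to [0] *)
Definition germO (m : nat) (f : R -> R) : Prop :=
  exists K : R, \forall t \near (0 : R), `|f t| <= K * `|t| ^+ m.

Lemma germOD m f g : germO m f -> germO m g -> germO m (fun t => f t + g t).
Proof.
move=> [K fK] [L gL]; exists (K + L); near=> t.
rewrite (le_trans (ler_normD _ _))// mulrDl lerD//; near: t; assumption.
Unshelve. all: by end_near. Qed.

Lemma germOZ m a f : germO m f -> germO m (fun t => a * f t).
Proof.
move=> [K fK]; exists (`|a| * K); near=> t.
rewrite normrM -mulrA ler_wpM2l//; near: t; assumption.
Unshelve. all: by end_near. Qed.

Lemma germO_sum m n (f : nat -> R -> R) : (forall j, (j < n)%N -> germO m (f j)) ->
  germO m (fun t => \sum_(j < n) f j t).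
Proof.
elim: n => [|n IH] fO.
  by exists 0; near=> t; rewrite big_ord0 normr0 mul0r.
rewrite (_ : (fun _ => _) = (fun t => \sum_(j < n) f j t + f n t)).
  by apply: germOD (fO _ _) => //; apply: IH => j /ltnW; exact: fO.
by apply/funext => t; rewrite big_ord_recr.
Unshelve. all: by end_near. Qed.

Lemma germO_near m f g :
  (\forall t \near (0 : R), f t = g t) -> germO m f -> germO m g.
Proof.
move=> fg [K fK]; exists K; near=> t.
have <- : f t = g t by near: t.
by near: t.
Unshelve. all: by end_near. Qed.

Lemma germOW m n f : (n <= m)%N -> germO m f -> germO n f.
Proof.
move=> nm [K fK]; exists `|K|; near=> t.
have t1 : `|t| < 1 by near: t; apply: (@nbhs0_lt R R^o).
have : `|f t| <= K * `|t| ^+ m by near: t.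
move=> /le_trans; apply; apply: (@le_trans _ _ (`|K| * `|t| ^+ m)).
  by apply: ler_wpM2r; [exact: exprn_ge0|exact: ler_norm].
by apply: ler_wpM2l => //; apply: ler_wiXn2l => //; exact: ltW.
Unshelve. all: by end_near. Qed.

Lemma germO_cvg0 f : germO 1 f -> f t @[t --> (0 : R)] --> (0 : R).
Proof.
move=> [K fK]; apply/(@cvgrPdist_le _ R^o) => e e0; near=> t.
have K0 : 0 < `|K| + 1 by rewrite ltr_wpDl.
rewrite sub0r normrN.
have : `|f t| <= K * `|t| ^+ 1 by near: t.
move=> /le_trans; apply; rewrite expr1.
have te : `|t| < e / (`|K| + 1) by near: t; apply: (@nbhs0_lt R R^o); exact: divr_gt0.
rewrite ltr_pdivlMr// in te; apply: le_trans (ltW te).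
by rewrite mulrC ler_wpM2l// (le_trans (ler_norm K))// lerDl.
Unshelve. all: by end_near. Qed.

(** The constant coefficient is the limit at [0]; divide the rest by [t] and
    recurse. *)
Lemma germO_coef m (B : nat -> R) :
  germO m (fun t => \sum_(q < m) B q * t ^+ q) -> forall q, (q < m)%N -> B q = 0.
Proof.
elim: m B => [//|m IH] B BO.
pose P (t : R) := \sum_(q < m) B q.+1 * t ^+ q.
have E t : \sum_(q < m.+1) B q * t ^+ q = B 0%N + t * P t.
  rewrite big_ord_recl expr0 mulr1 mulr_sumr; congr (_ + _).
  by apply: eq_bigr => i _; rewrite lift0 exprS mulrCA.
have B0 : B 0%N = 0.
  have h1 : \sum_(q < m.+1) B q * t ^+ q @[t --> (0 : R)] --> (0 : R).
    exact: germO_cvg0 (germOW (ltn0Sn _) BO).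
  pose p : {poly R} := \poly_(q < m.+1) B q.
  have h2 : \sum_(q < m.+1) B q * t ^+ q @[t --> (0 : R)] --> B 0%N.
    have -> : B 0%N = p.[0] by rewrite horner_coef0 coef_poly.
    rewrite (_ : (fun t => _) = horner p); first exact: continuous_horner.
    by apply/funext => t; rewrite horner_poly.
  exact: (@cvg_unique R^o (@norm_hausdorff _ R^o) _ (fmap_proper_filter _ _)
    _ _ h2 h1).
case=> // q; rewrite ltnS; apply: (IH (fun q => B q.+1)).
case: BO => K BK.
exists `|K|.
have PK : \forall t \near (0 : R)^', `|P t| <= `|K| * `|t| ^+ m.
  have BK' := nbhs_dnbhs BK; near=> t.
  have t0 : t != 0 by near: t; exact: nbhs_dnbhs_neq.
  have : `|\sum_(q < m.+1) B q * t ^+ q| <= K * `|t| ^+ m.+1 by near: t.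
  rewrite E B0 add0r normrM exprSr mulrA mulrC ler_pM2r ?normr_gt0//.
  move=> /le_trans; apply; apply: ler_wpM2r; first exact: exprn_ge0.
  exact: ler_norm.
(* the punctured estimate extends to 0 by continuity *)
have P0 : `|P 0| <= `|K| * `|0 : R| ^+ m.
  case: m @P IH E PK BK => [|m] P IH E PK BK.
    by rewrite /P big_ord0 normr0 mulr_ge0.
  pose p : {poly R} := \poly_(q < m.+1) B q.+1.
  have pP : P = horner p by apply/funext => t; rewrite horner_poly.
  have h2 : P t @[t --> (0 : R)^'] --> P 0.
    by rewrite pP; apply: cvg_within_filter; exact: continuous_horner.
  have h1 : P t @[t --> (0 : R)^'] --> (0 : R).
    apply/(@cvgrPdist_le _ R^o) => e e0; near=> t.
    have K0 : 0 < `|K| + 1 by rewrite ltr_wpDl.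
    rewrite sub0r normrN.
    have : `|P t| <= `|K| * `|t| ^+ m.+1 by near: t.
    move=> /le_trans; apply.
    have te : `|t| < e / (`|K| + 1) by near: t; apply: dnbhs0_lt; exact: divr_gt0.
    have t1 : `|t| < 1 by near: t; exact: dnbhs0_lt.
    rewrite ltr_pdivlMr// in te; apply: le_trans (ltW te).
    rewrite mulrC; apply: ler_pM; rewrite ?exprn_ge0 ?lerDl//.
    by rewrite exprS ler_piMr// exprn_ile1// ltW.
  have -> : P 0 = 0.
    exact: (@cvg_unique R^o (@norm_hausdorff _ R^o) _ (fmap_proper_filter _ _)
      _ _ h2 h1).
  by rewrite normr0 mulr_ge0// exprn_ge0.
near=> t; have [->//|t0] := eqVneq t 0.
by move: t0; near: t; exact: PK.
Unshelve. all: by end_near. Qed.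

(** Weights extracting one coefficient of a polynomial of degree below [m] from
    its values at [m] distinct points: a column of the inverse Vandermonde
    matrix. *)
Lemma extraction_weights (m p : nat) : (p < m)%N ->
  exists lam mu : nat -> R, forall q, (q < m)%N ->
    \sum_(j < m) mu j * lam j ^+ q = (q == p)%:R.
Proof.
move=> pm; pose a : 'rV[R]_m := \row_j (j : nat)%:R.
have Vu : Vandermonde m a \in unitmx.
  rewrite unitmxE det_Vandermonde unitfE; apply/prodf_neq0 => i _.
  apply/prodf_neq0 => j ij.
  by rewrite !mxE subr_eq0 eqr_nat gtn_eqF.
pose w := invmx (Vandermonde m a) *m delta_mx (Ordinal pm) (0 : 'I_1).
exists (fun j => j%:R), (fun j => if insub j is Some i then w i 0 else 0) => q qm.
have : Vandermonde m a *m w = delta_mx (Ordinal pm) 0.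
  by rewrite mulmxA mulmxV// mul1mx.
move=> /matrixP/(_ (Ordinal qm) 0); rewrite !mxE andbT -val_eqE/= => <-.
by apply: eq_bigr => j _; rewrite valK !mxE mulrC.
Qed.

End MeanValue.

(** * Functions of two variables that are smooth along curves *)

Section PlaneFunctions.
Context {R : realType}.

Definition plane_smooth (E : tvsType R) (F : R -> R -> E) : Prop :=
  forall s t : R^o -> R^o, smooth_curve s -> smooth_curve t ->
    smooth_curve (fun u => F (s u) (t u)).

Lemma special_plane_curve (s0 t0 a b : R) (s t : nat -> R) :
  `|a| <= 1 -> `|b| <= 1 ->
  (forall k, `|s k - s0| <= 2^-1 ^+ (k ^ 2)) ->
  (forall k, `|t k - t0| <= 2^-1 ^+ (k ^ 2)) ->
  exists sig tau : R^o -> R^o, [/\ smooth_curve sig, smooth_curve tau,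
    sig 0 = s0, tau 0 = t0 & forall k u, `|u - knot k| <= knot k / 8 ->
      sig u = s k + 2^-1 ^+ (k ^ 2) * a * (u - knot k) /\
      tau u = t k + 2^-1 ^+ (k ^ 2) * b * (u - knot k)].
Proof.
move=> a1 b1 ss tt.
have fast (x : R) k : `|x| <= 1 -> `|2^-1 ^+ (k ^ 2) * x| <= 2^-1 ^+ (k ^ 2) :> R.
  move=> x1; rewrite normrM ger0_norm ?exprn_ge0// ler_piMr// exprn_ge0//.
have [A sA [A0 AE]] := special_curve ss (fun k => fast a k a1).
have [B sB [B0 BE]] := special_curve tt (fun k => fast b k b1).
have scst x : smooth_curve (fun=> x : R^o) by exact: smooth_cst hausdorff_real.
exists (fun u => s0 + A u), (fun u => t0 + B u); split.
- exact: smoothD hausdorff_real (scst _) sA.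
- exact: smoothD hausdorff_real (scst _) sB.
- by rewrite A0 addr0.
- by rewrite B0 addr0.
move=> k u uk; rewrite (AE k u uk) (BE k u uk).
by split; rewrite addrA [_ + (_ - _)]addrC subrK.
Qed.

Lemma near_knot (P : R -> Prop) : (\forall u \near (0 : R), P u) ->
  exists K, forall k, (K <= k)%N -> P (knot k).
Proof.
move=> P0; have : (fun k => knot k : R) @ \oo --> (0 : R).
  by apply: cvg_expr; rewrite ger0_norm ?invr_ge0// invf_lt1// ltr1n.
by move=> /(_ _ P0)[K _ KP]; exists K.
Qed.

(** Otherwise a special curve runs through counterexamples converging fast to
    [(s0, t0)].  In other words, the topology that smooth curves induce on the
    plane is the usual one. *)
Lemma near_plane (W : R -> R -> Prop) (s0 t0 : R) :
  (forall s t : R^o -> R^o, smooth_curve s -> smooth_curve t ->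
    s 0 = s0 -> t 0 = t0 -> \forall u \near (0 : R), W (s u) (t u)) ->
  exists2 e : R, 0 < e & forall s t, `|s - s0| <= e -> `|t - t0| <= e -> W s t.
Proof.
move=> near_curve; apply: contrapT => noW.
have bad k : exists z : R * R, [/\ `|z.1 - s0| <= 2^-1 ^+ (k ^ 2),
    `|z.2 - t0| <= 2^-1 ^+ (k ^ 2) & ~ W z.1 z.2].
  apply: contrapT => good; apply: noW; exists (2^-1 ^+ (k ^ 2)).
    by rewrite exprn_gt0.
  by move=> s t ss tt; apply: contrapT => nW; apply: good; exists (s, t).
have [z zP] := choice bad.
have n0 : `|0 : R| <= 1 by rewrite normr0.
have [||s [t [ss st s00 t00 stE]]] :=
    @special_plane_curve s0 t0 0 0 (fun k => (z k).1) (fun k => (z k).2) n0 n0.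
- by move=> k; case: (zP k).
- by move=> k; case: (zP k).
have [K KW] := near_knot (near_curve s t ss st s00 t00).
have [_ _] := zP K; apply.
have := stE K (knot K); rewrite subrr normr0 !mulr0 !addr0 divr_ge0 ?ltW ?knot_gt0//.
by move=> /(_ isT)[<- <-]; exact: KW.
Qed.

Definition pderiv (F : R -> R -> R^o) p (a b s t : R) : R :=
  iter p (@velocity R R^o) (fun u : R^o => F (s + a * u) (t + b * u)) 0.

Variable F : R -> R -> R^o.
Hypothesis sF : plane_smooth F.

Lemma smooth_line a b s t :
  smooth_curve (fun u : R^o => F (s + a * u) (t + b * u)).
Proof. by apply: sF; exact: smooth_affine. Qed.

Lemma iter_velocity_line p a b s t (u : R) :
  iter p (@velocity R R^o) (fun u : R^o => F (s + a * u) (t + b * u)) u =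
  pderiv F p a b (s + a * u) (t + b * u).
Proof.
have := iter_velocity_affine u 1 p 0 (smooth_line a b s t).
rewrite mulr0 addr0 expr1n mul1r => <-; rewrite /pderiv; congr (iter _ _ _ _).
by apply/funext => v; rewrite mul1r !mulrDr !addrA.
Qed.

Lemma pderivZ p l a b s t :
  pderiv F p (l * a) (l * b) s t = l ^+ p * pderiv F p a b s t.
Proof.
have := iter_velocity_affine 0 l p 0 (smooth_line a b s t).
rewrite mulr0 addr0 => <-; rewrite /pderiv; congr (iter _ _ _ _).
by apply/funext => v; rewrite !mulrDr !mulr0 !add0r !mulrA ![l * _]mulrC.
Qed.

(** Otherwise a special curve runs through points [z k] at which the derivative
    outgrows every power of [2^(k^2)].  It passes there in the direction [(a, b)]
    with speed of order [2^-(k^2)], so its image under [F] would have unbounded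
    [p]-th derivatives near [0]. *)
Lemma pderiv_bounded p a b s0 t0 : exists2 C : R, 0 <= C &
  exists2 e : R, 0 < e & forall s t, `|s - s0| <= e -> `|t - t0| <= e ->
    `|pderiv F p a b s t| <= C.
Proof.
apply: contrapT => unbounded.
pose eta k : R := 2^-1 ^+ (k ^ 2).
have eta0 k : 0 < eta k by rewrite exprn_gt0.
pose L := 1 + `|a| + `|b|.
have L0 : 0 < L by rewrite /L -addrA ltr_wpDr ?addr_ge0 ?ltr01.
have bad k : exists z : R * R, [/\ `|z.1 - s0| <= eta k, `|z.2 - t0| <= eta k &
    k%:R * (L / eta k) ^+ p < `|pderiv F p a b z.1 z.2|].
  apply: contrapT => good; apply: unbounded; exists (k%:R * (L / eta k) ^+ p).
    by rewrite mulr_ge0// exprn_ge0// divr_ge0// ltW.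
  exists (eta k) => // s t ss tt; rewrite leNgt; apply/negP => big.
  by apply: good; exists (s, t).
have [z zP] := choice bad.
have aL : `|L^-1 * a| <= 1.
  by rewrite normrM normfV (gtr0_norm L0) ler_pdivrMl// mulr1 /L addrAC lerDr addr_ge0.
have bL : `|L^-1 * b| <= 1.
  by rewrite normrM normfV (gtr0_norm L0) ler_pdivrMl// mulr1 /L lerDr addr_ge0.
have [||s [t [ss st s00 t00 stE]]] :=
    @special_plane_curve s0 t0 _ _ (fun k => (z k).1) (fun k => (z k).2) aL bL.
- by move=> k; case: (zP k).
- by move=> k; case: (zP k).
pose c (u : R^o) := F (s u) (t u); have sc : smooth_curve c by exact: sF.
have dc k : iter p (@velocity R R^o) c (knot k) =
    (eta k / L) ^+ p * pderiv F p a b (z k).1 (z k).2.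
  pose d (u : R^o) := F ((z k).1 + eta k / L * a * u) ((z k).2 + eta k / L * b * u).
  have sd : smooth_curve d by exact: smooth_line.
  have cd : \forall u \near (knot k : R), c u = d (- knot k + 1 * u).
    have k8 : 0 < knot k / 8 :> R by rewrite divr_gt0// knot_gt0.
    have : \forall u \near (knot k : R), `|knot k - u| < knot k / 8.
      exact: (@cvgr_dist_lt R R^o _ _ _ id (knot k) cvg_id _ k8).
    apply: filterS => u uk; rewrite /c /d.
    have [|-> ->] := stE k u; first by rewrite distrC ltW.
    by rewrite mul1r [- _ + u]addrC !mulrA.
  have sd' : smooth_curve (fun u : R^o => d (- knot k + 1 * u)).
    exact: (smooth_comp hausdorff_real (smooth_affine _ _) sd).
  rewrite (nbhs_singleton (near_iter_velocity p hausdorff_real sd' cd)).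
  rewrite (iter_velocity_affine _ _ _ _ sd) expr1n !mul1r addrC subrr.
  exact: pderivZ.
have cont : {for (0 : R), continuous (iter p (@velocity R R^o) c : R -> R)}.
  exact: smooth_continuous hausdorff_real (smooth_iter_velocity p sc) 0.
pose M := `|iter p (@velocity R R^o) c 0| + 1.
have : \forall u \near (0 : R), `|iter p (@velocity R R^o) c u| <= M.
  by apply: (@cvgr_norm_le R R^o _ _ _ _ _ cont); rewrite ltrDl.
move=> /near_knot[K KM].
pose k := maxn K (Num.truncn M).+1.
have := KM k (leq_maxl _ _); apply/negP; rewrite -ltNge dc normrM.
have [_ _ big] := zP k.
have E : (eta k / L) ^+ p * (k%:R * (L / eta k) ^+ p) = k%:R.
  rewrite mulrCA -exprMn mulrA divfK ?gt_eqF// divff ?gt_eqF//.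
  by rewrite expr1n mulr1.
have Mk : M < k%:R.
  by apply: lt_le_trans (truncnS_gt M) _; rewrite ler_nat leq_maxr.
apply: (lt_trans Mk); rewrite -E.
have el : 0 < (eta k / L) ^+ p by rewrite exprn_gt0// divr_gt0.
by rewrite (gtr0_norm el) ltr_pM2l.
Qed.

End PlaneFunctions.

(** ** Differentiating Taylor coefficients *)

Section TaylorCoefficients.
Context {R : realType}.
Variable F : R -> R -> R^o.
Hypothesis sF : plane_smooth F.

Definition tcoef p (a b s t : R) : R := pderiv F p a b s t / p`!%:R.

Lemma tcoef_taylor m a b s0 t0 : exists2 K : R, 0 <= K &
  exists2 r : R, 0 < r & forall s t u,
    `|s - s0| <= r -> `|t - t0| <= r -> `|u| <= r ->
    `|F (s + a * u) (t + b * u) - \sum_(q < m) tcoef q a b s t * u ^+ q|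
      <= K * `|u| ^+ m.
Proof.
have [C C0 [e e0 bounded]] := pderiv_bounded sF m a b s0 t0.
exists C => //; pose L := 1 + `|a| + `|b|.
have L0 : 0 < L by rewrite /L -addrA ltr_wpDr ?addr_ge0 ?ltr01.
exists (e / L); first exact: divr_gt0.
move=> s t u ss tt ur.
have aux x y y0 : `|y - y0| <= e / L -> 1 + `|x| <= L -> forall v : R,
    `|v| <= e / L -> `|y + x * v - y0| <= e.
  move=> yy xL v vr; rewrite addrAC (le_trans (ler_normD _ _))// normrM.
  have -> : e = e / L + (L - 1) * (e / L) by field; rewrite gt_eqF.
  by apply: lerD => //; apply: ler_pM => //; lra.
have cC : forall v : R, `|v| <= e / L -> `|iter m (@velocity R R^o)
    (fun u : R^o => F (s + a * u) (t + b * u)) v| <= C.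
  move=> v vr; rewrite iter_velocity_line//; apply: bounded.
    by apply: aux => //; rewrite /L lerDl.
  by apply: aux => //; rewrite /L addrAC lerDl.
have := taylor_bound (smooth_line sF a b s t) cC ur.
by rewrite /taylor horner_poly.
Qed.

Section Weights.
Variables (p : nat) (lam mu : nat -> R).
Hypothesis weights : forall q, (q < p.+2)%N ->
  \sum_(j < p.+2) mu j * lam j ^+ q = (q == p)%:R.

(** A weighted sum of values of [F] along one line isolates one term of the Taylor
    expansion, uniformly in the base point. *)
Lemma extract_tcoef a b s0 t0 : exists2 K : R, 0 <= K &
  exists2 r : R, 0 < r & forall s t h,
    `|s - s0| <= r -> `|t - t0| <= r -> `|h| <= r ->
    `|\sum_(j < p.+2) mu j * F (s + a * (lam j * h)) (t + b * (lam j * h))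
      - h ^+ p * tcoef p a b s t| <= K * `|h| ^+ p.+2.
Proof.
have [K K0 [r r0 taylor]] := tcoef_taylor p.+2 a b s0 t0.
pose L := 1 + \sum_(j < p.+2) `|lam j|.
have L1 : 1 <= L by rewrite lerDl sumr_ge0.
have L0 : 0 < L := lt_le_trans ltr01 L1.
have lamL (j : 'I_p.+2) : `|lam j| <= L.
  by rewrite /L (bigD1 j)//= addrCA lerDl addr_ge0// sumr_ge0.
exists (\sum_(j < p.+2) `|mu j| * (K * L ^+ p.+2)).
  by apply: sumr_ge0 => j _; rewrite mulr_ge0// mulr_ge0// exprn_ge0// ltW.
exists (r / L); first exact: divr_gt0.
have rL : r / L <= r by rewrite ler_pdivrMr// ler_peMr// ltW.
move=> s t h sr tr hr.
have -> : h ^+ p * tcoef p a b s t = \sum_(j < p.+2)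
    mu j * \sum_(q < p.+2) tcoef q a b s t * (lam j * h) ^+ q.
  under eq_bigr do rewrite mulr_sumr; rewrite exchange_big/=.
  have H (q : 'I_p.+2) : \sum_(j < p.+2) mu j * (tcoef q a b s t * (lam j * h) ^+ q)
      = (val q == p)%:R * (tcoef q a b s t * h ^+ q).
    rewrite -(weights (ltn_ord q)) mulr_suml; apply: eq_bigr => j _; rewrite exprMn; ring.
  under eq_bigr do rewrite H.
  rewrite (bigD1 (Ordinal (ltnW (ltnSn p.+1))))//= eqxx mul1r big1 ?addr0.
    by rewrite mulrC.
  by move=> q; rewrite -val_eqE/= => /negPf ->; rewrite mul0r.
rewrite -sumrB mulr_suml (le_trans (ler_norm_sum _ _ _))//.
apply: ler_sum => j _; rewrite -mulrBr normrM -mulrA ler_wpM2l//.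
have lh : `|lam j * h| <= L * `|h| by rewrite normrM ler_wpM2r.
have ljr : `|lam j * h| <= r.
  by rewrite (le_trans lh)// mulrC -ler_pdivlMr.
apply: le_trans (taylor _ _ _ (le_trans sr rL) (le_trans tr rL) ljr) _.
rewrite -mulrA ler_wpM2l// -exprMn; apply: lerXn2r => //; rewrite nnegrE//.
by rewrite mulr_ge0// ltW.
Qed.

Variables (a b a' b' s t : R).

Let G (h : R) : R := tcoef p a b (s + a' * h) (t + b' * h).

Let B q : R := \sum_(j < p.+2) mu j * tcoef q (a' + lam j * a) (b' + lam j * b) s t.

Let near_box (x r : R) : 0 < r -> \forall h \near (0 : R), `|x * h| <= r.
Proof.
move=> r0; near=> h; rewrite normrM.
have x0 : 0 < `|x| + 1 by rewrite ltr_wpDl.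
have hr : `|h| < r / (`|x| + 1).
  by near: h; apply: (@nbhs0_lt R R^o); exact: divr_gt0.
rewrite ltr_pdivlMr// in hr; apply: le_trans (ltW hr); rewrite mulrC.
by rewrite ler_wpM2l// lerDl.
Unshelve. all: by end_near. Qed.

(* G is a locally uniform limit of difference quotients of F *)
Let G_cont : G h @[h --> (0 : R)] --> G 0.
Proof.
apply/(@cvgrPdist_le _ R^o) => e e0.
have [K K0 [r r0 ext]] := extract_tcoef a b s t.
(* the step at which the difference quotient determines G up to e *)
pose h := Num.min r (Num.min 1 (e / (4 * (K + 1)))).
have K1 : 0 < 4 * (K + 1) by rewrite mulr_gt0// ltr_wpDl.
have h0 : 0 < h by rewrite !lt_min r0 ltr01 divr_gt0.
have hr : `|h| <= r by rewrite gtr0_norm// ge_min lexx.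
have he : 2 * K * h ^+ 2 <= e / 2.
  have h1 : h <= 1 by rewrite !ge_min lexx orbT.
  have h2 : h * (4 * (K + 1)) <= e by rewrite -ler_pdivlMr// !ge_min lexx !orbT.
  have : K * h * h <= K * h * 1 by rewrite ler_wpM2l// mulr_ge0// ltW.
  by rewrite expr2; lra.
pose S (u : R^o) : R^o := \sum_(j < p.+2) mu j *
  F (s + a' * u + a * (lam j * h)) (t + b' * u + b * (lam j * h)).
have aff (x y z : R) : smooth_curve (fun u : R^o => x + y * u + z : R^o).
  rewrite (_ : (fun _ => _) = (fun u : R^o => (x + z) + y * u : R^o)).
    exact: smooth_affine.
  by apply/funext => u; rewrite addrAC.
have S_cont : {for (0 : R), continuous (S : R -> R)}.
  apply: (@smooth_continuous R R^o); first exact: hausdorff_real.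
  rewrite /S; elim: p.+2 => [|n IH].
    rewrite (_ : (fun _ => _) = fun=> 0); first exact: smooth_cst hausdorff_real.
    by apply/funext => u; rewrite big_ord0.
  rewrite (_ : (fun _ => _) = (fun u : R^o => \sum_(j < n) mu j *
    F (s + a' * u + a * (lam j * h)) (t + b' * u + b * (lam j * h)) +
    mu n * F (s + a' * u + a * (lam n * h)) (t + b' * u + b * (lam n * h)))).
    apply: smoothD hausdorff_real IH _; apply: smoothM.
      exact: smooth_cst hausdorff_real.
    by apply: sF; exact: aff.
  by apply/funext => u; rewrite big_ord_recr.
have hp : 0 < h ^+ p by rewrite exprn_gt0.
have hpe : 0 < h ^+ p * (e / 2) by rewrite mulr_gt0// divr_gt0.
near=> u.
have Su : `|S 0 - S u| <= h ^+ p * (e / 2).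
  near: u; exact: (@cvgr_dist_le R R^o _ _ _ S _ S_cont _ hpe).
have su : `|a' * u| <= r by near: u; exact: near_box.
have tu : `|b' * u| <= r by near: u; exact: near_box.
have E1 : `|S u - h ^+ p * G u| <= K * `|h| ^+ p.+2.
  by apply: ext => //; rewrite addrC addKr.
have E0 : `|S 0 - h ^+ p * G 0| <= K * `|h| ^+ p.+2.
  by apply: ext => //; rewrite mulr0 addr0 subrr normr0 ltW.
rewrite -(ler_pM2l hp) -[X in X * `|_|](gtr0_norm hp) -normrM mulrBr.
have -> : h ^+ p * G 0 - h ^+ p * G u =
  (S 0 - S u) + (- (S 0 - h ^+ p * G 0) + (S u - h ^+ p * G u)) by ring.
apply: (le_trans (ler_normD _ _)).
have E2 := ler_normD (- (S 0 - h ^+ p * G 0)) (S u - h ^+ p * G u).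
rewrite normrN in E2.
have : h ^+ p * (2 * K * h ^+ 2) <= h ^+ p * (e / 2) by rewrite ler_pM2l.
have : K * `|h| ^+ p.+2 = h ^+ p * (K * h ^+ 2).
  by rewrite gtr0_norm// -addn2 exprD; ring.
by lra.
Unshelve. all: by end_near. Qed.

(* the points of the weighted sum lie on lines through (s, t) in the directions
   (a', b') + lam j (a, b), which gives the second expansion *)
Let expansion : germO p.+2 (fun h => h ^+ p * G h - \sum_(q < p.+2) B q * h ^+ q).
Proof.
pose S (h : R) := \sum_(j < p.+2) mu j *
  F (s + a' * h + a * (lam j * h)) (t + b' * h + b * (lam j * h)).
have O1 : germO p.+2 (fun h => S h - h ^+ p * G h).
  have [K K0 [r r0 ext]] := extract_tcoef a b s t.
  exists K; near=> h; apply: ext.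
  - by rewrite addrC addKr; near: h; exact: near_box.
  - by rewrite addrC addKr; near: h; exact: near_box.
  by near: h; apply: filterS (near_box 1 r0) => h; rewrite mul1r.
have O2 : germO p.+2 (fun h => S h - \sum_(q < p.+2) B q * h ^+ q).
  have O3 j : (j < p.+2)%N -> germO p.+2 (fun h => mu j *
      (F (s + a' * h + a * (lam j * h)) (t + b' * h + b * (lam j * h)) -
       \sum_(q < p.+2) tcoef q (a' + lam j * a) (b' + lam j * b) s t * h ^+ q)).
    move=> _; apply: germOZ.
    have [K K0 [r r0 tay]] :=
      tcoef_taylor p.+2 (a' + lam j * a) (b' + lam j * b) s t.
    exists K; near=> h; have hr : `|h| <= r.
      by near: h; apply: filterS (near_box 1 r0) => h; rewrite mul1r.
    have := tay s t h; rewrite !subrr normr0 => /(_ (ltW r0) (ltW r0) hr).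
    rewrite !mulrDl !addrA; congr (`|F (_ + _) (_ + _) - _| <= _); ring.
  apply: germO_near (germO_sum O3); near=> h.
  under eq_bigr do rewrite mulrBr; rewrite sumrB; congr (_ - _).
  under eq_bigr do rewrite mulr_sumr; rewrite exchange_big/=.
  apply: eq_bigr => q _; rewrite /B mulr_suml.
  by apply: eq_bigr => j _; rewrite mulrA.
apply: germO_near (germOD O2 (germOZ (-1) O1)); near=> h.
by rewrite mulN1r opprB addrC subrKA.
Unshelve. all: by end_near. Qed.

Let B_small q : (q < p)%N -> B q = 0.
Proof.
move: q; apply: germO_coef.
have O1 : germO p (fun h => h ^+ p * G h).
  exists (`|G 0| + 1); near=> h; rewrite normrM normrX mulrC.
  apply: ler_wpM2r; first exact: exprn_ge0.
  by near: h; apply: (@cvgr_norm_le R R^o _ _ _ _ _ G_cont); rewrite ltrDl.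
have O2 : germO p (fun h => B p * h ^+ p).
  by exists `|B p|; near=> h; rewrite normrM normrX.
have O3 : germO p (fun h => B p.+1 * h ^+ p.+1).
  apply: (germOW (leqnSn p)).
  by exists `|B p.+1|; near=> h; rewrite normrM normrX.
have O4 := germOW (leqW (leqnSn p)) expansion.
apply: germO_near (germOD (germOD O1 (germOZ (-1) O4))
  (germOZ (-1) (germOD O2 O3))); near=> h.
by rewrite !big_ord_recr/=; ring.
Unshelve. all: by end_near. Qed.

(** Expanding [F] at [(s + a' h, t + b' h)] and at [(s, t)] in two ways turns
    the extraction formula for a Taylor coefficient into its first order
    expansion in [h]. *)
Lemma tcoef_derivE : tcoef p a b s t = B p /\
  has_deriv (E := R^o) (fun h : R^o => tcoef p a b (s + a' * h) (t + b' * h)) 0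
    (B p.+1).
Proof.
have [K OK] : germO p.+2 (fun h => h ^+ p * (G h - B p - B p.+1 * h)).
  apply: germO_near expansion; near=> h; rewrite !big_ord_recr/= big1 ?add0r.
    by rewrite exprS; ring.
  by move=> q _; rewrite B_small// mul0r.
have est : \forall h \near (0 : R)^', `|G h - B p - B p.+1 * h| <= K * h ^+ 2.
  have OK' := nbhs_dnbhs OK; near=> h.
  have h0 : h != 0 by near: h; exact: nbhs_dnbhs_neq.
  have hp : 0 < `|h| ^+ p by rewrite exprn_gt0// normr_gt0.
  rewrite -(ler_pM2l hp) -{1}normrX -normrM.
  have : `|h ^+ p * (G h - B p - B p.+1 * h)| <= K * `|h| ^+ p.+2 by near: h.
  by rewrite -addn2 exprD real_normK ?num_real// mulrCA.
have G0 : G 0 = B p.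
  have h1 : G h @[h --> (0 : R)^'] --> G 0.
    by apply: cvg_trans G_cont; apply: cvg_app; exact: nbhs_dnbhs.
  have h2 : G h @[h --> (0 : R)^'] --> B p.
    apply/(@cvgrPdist_le _ R^o) => e e0.
    pose L := `|K| + `|B p.+1| + 1.
    have L0 : 0 < L by rewrite ltr_wpDl// addr_ge0.
    near=> h.
    have h1' : `|h| < 1 by near: h; apply: (@dnbhs0_lt R R^o).
    have hL : `|h| < e / L by near: h; apply: (@dnbhs0_lt R R^o); exact: divr_gt0.
    have eh : `|G h - B p - B p.+1 * h| <= K * h ^+ 2 by near: h.
    rewrite ltr_pdivlMr// in hL; apply: le_trans (ltW hL).
    rewrite distrC -(subrK (B p.+1 * h) (G h - B p)).
    rewrite (le_trans (ler_normD _ _))// normrM.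
    have : K * h ^+ 2 <= `|K| * `|h|.
      rewrite -(real_normK (num_real h)) expr2 mulrA.
      apply: (@le_trans _ _ (`|K| * `|h| * `|h|)).
        by rewrite !ler_wpM2r// ler_norm.
      by rewrite ler_piMr// ?mulr_ge0// ltW.
    by have := normr_ge0 h; rewrite /L; lra.
  exact: (@cvg_unique R^o (@norm_hausdorff _ R^o) _ (fmap_proper_filter _ _)
    _ _ h1 h2).
split; first by rewrite -G0 /G !mulr0 !addr0.
apply: (@has_deriv_quadratic _ _ _ _ K); near=> h.
rewrite add0r -/(G h) -/(G 0) G0.
have [->|h0] := eqVneq h 0; last first.
  by rewrite [h * _]mulrC; move: h0; near: h; exact: est.
by rewrite G0 subrr mul0r subr0 normr0 expr0n mulr0.
Unshelve. all: by end_near. Qed.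

End Weights.
End TaylorCoefficients.

(** ** Consequences for first derivatives *)

Section PlaneConsequences.
Context {R : realType}.

Lemma ndiff_sum n m (c : nat -> R^o -> R^o) : (forall j, ndiff n (c j)) ->
  ndiff n (fun t => \sum_(j < m) c j t : R^o).
Proof.
move=> nc; elim: m => [|m IH].
  rewrite (_ : (fun _ => _) = fun=> 0); first exact: ndiff_cst.
  by apply/funext => s; rewrite big_ord0.
rewrite (_ : (fun _ => _) = (fun t => \sum_(j < m) c j t + c m t)).
  exact: ndiffD.
by apply/funext => s; rewrite big_ord_recr.
Qed.

Lemma has_deriv_shift (E : tvsType R) (c : R^o -> E) (t : R^o) (l : E) :
  has_deriv (fun h => c (t + h)) 0 l -> has_deriv c t l.
Proof.
move=> /has_derivE[q [cq ql]]; apply/has_derivE; exists q; split=> // h.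
by have := cq h; rewrite add0r addr0.
Qed.

Variable F : R -> R -> R^o.
Hypothesis sF : plane_smooth F.

(** The derivative of a Taylor coefficient is a linear combination of Taylor
    coefficients of the next order, in other directions. *)
Lemma smooth_tcoef p a b s t a' b' :
  smooth_curve (fun u : R^o => tcoef F p a b (s + a' * u) (t + b' * u) : R^o).
Proof.
apply/(smooth_curveP _ hausdorff_real) => n.
elim: n p a b => // n IH p a b.
have [lam [mu weights]] := @extraction_weights R p.+2 p (leqW (ltnSn p)).
pose d j (u : R^o) : R^o := mu j * tcoef F p.+1 (a' + lam j * a) (b' + lam j * b)
  (s + a' * u) (t + b' * u).
exists (fun u => \sum_(j < p.+2) d j u); split=> [u|].
  apply: has_deriv_shift.
  have [_] := tcoef_derivE sF weights a b a' b' (s + a' * u) (t + b' * u).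
  by under eq_fun do rewrite -!addrA -!mulrDr.
apply: (@ndiff_sum n p.+2 d) => j.
by apply: ndiffZ (IH _ _ _); exact: ndiff_cst.
Qed.

Lemma tcoef1 a b s t : tcoef F 1 a b s t = pderiv F 1 a b s t.
Proof. by rewrite /tcoef divr1. Qed.

Lemma smooth_pderiv a b s t a' b' :
  smooth_curve (fun u : R^o => pderiv F 1 a b (s + a' * u) (t + b' * u) : R^o).
Proof.
have := smooth_tcoef 1 a b s t a' b'; congr smooth_curve.
by apply/funext => u; rewrite tcoef1.
Qed.

(* the weights 0, 1/2, -1/2 at 0, 1, -1 extract the linear coefficient *)
Let lam (j : nat) : R := if j == 1%N then 1 else if j == 2%N then -1 else 0.
Let mu (j : nat) : R := lam j / 2.

Let weights q : (q < 3)%N -> \sum_(j < 3) mu j * lam j ^+ q = (q == 1%N)%:R.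
Proof.
by case: q => [|[|[|]]]// _; rewrite !big_ord_recr big_ord0/= /mu /lam/=; lra.
Qed.

Let mixed q a b a' b' s t :
  \sum_(j < 3) mu j * tcoef F q (a' + lam j * a) (b' + lam j * b) s t =
  (tcoef F q (a' + a) (b' + b) s t - tcoef F q (a' - a) (b' - b) s t) / 2.
Proof.
by rewrite !big_ord_recr big_ord0/= /mu /lam/= !mul1r !mulN1r; ring.
Qed.

Lemma pderivN p a b s t :
  pderiv F p (- a) (- b) s t = (- 1) ^+ p * pderiv F p a b s t.
Proof. by rewrite -pderivZ// !mulN1r. Qed.

(** Extracting the linear coefficient with the weights [0, 1/2, -1/2] gives
    [P(w + v) - P(w - v) = 2 P(v)]; exchange [v] and [w] and add. *)
Lemma pderivD a b a' b' s t :
  pderiv F 1 (a + a') (b + b') s t = pderiv F 1 a b s t + pderiv F 1 a' b' s t.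
Proof.
have [E1 _] := tcoef_derivE sF weights a b a' b' s t.
have [E2 _] := tcoef_derivE sF weights a' b' a b s t.
move: E1 E2; rewrite !mixed !tcoef1 -(opprB a a') -(opprB b b') pderivN expr1.
by rewrite [a' + a]addrC [b' + b]addrC; lra.
Qed.

(** Both mixed derivatives are the same combination of second derivatives in
    the directions [(a + a', b + b')] and [(a - a', b - b')]. *)
Lemma pderiv_sym a b a' b' s t : exists l : R,
  has_deriv (E := R^o) (fun u => pderiv F 1 a b (s + a' * u) (t + b' * u)) 0 l /\
  has_deriv (E := R^o) (fun u => pderiv F 1 a' b' (s + a * u) (t + b * u)) 0 l.
Proof.
have [_ D1] := tcoef_derivE sF weights a b a' b' s t.
have [_ D2] := tcoef_derivE sF weights a' b' a b s t.
exists ((tcoef F 2 (a' + a) (b' + b) s t - tcoef F 2 (a' - a) (b' - b) s t) / 2).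
split.
  by move: D1; rewrite mixed; under eq_fun do rewrite tcoef1.
move: D2; rewrite mixed -(opprB a' a) -(opprB b' b) [in X in X - _]/tcoef.
rewrite [a + a']addrC [b + b']addrC.
have -> : tcoef F 2 (- (a' - a)) (- (b' - b)) s t = tcoef F 2 (a' - a) (b' - b) s t.
  by rewrite /tcoef pderivN sqrrN expr1n mul1r.
by under eq_fun do rewrite tcoef1.
Qed.

End PlaneConsequences.

(** ** Difference quotients of smooth functions *)

Section Hadamard.
Context {R : realType}.

(** The Taylor remainder of order [m] divided by the [m]-th power, with its limit as
    value at [0] *)
Definition remainder (h : R^o -> R^o) m (t : R^o) : R^o :=
  if t == 0 then iter m (@velocity R R^o) h 0 / m`!%:R
  else (h t - (taylor h m).[t]) / t ^+ m.

(** The linear span of all remainders is stable under differentiation; this makes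
    them smooth. *)
Lemma has_deriv_remainder (h : R^o -> R^o) m (t : R^o) : smooth_curve h ->
  has_deriv (remainder h m) t
    (remainder (velocity h) m t + (- m%:R) * remainder h m.+1 t).
Proof.
move=> sh; have f0 n : n`!%:R != 0 :> R by rewrite pnatr_eq0 -lt0n fact_gt0.
have [->|t0] := eqVneq t 0.
  have cont : {for (0 : R), continuous (iter m.+2 (@velocity R R^o) h : R -> R)}.
    exact: smooth_continuous hausdorff_real (smooth_iter_velocity _ sh) 0.
  pose K := `|iter m.+2 (@velocity R R^o) h 0| + 1.
  have : \forall u \near (0 : R), `|iter m.+2 (@velocity R R^o) h u| <= K.
    by apply: (@cvgr_norm_le R R^o _ _ _ _ _ cont); rewrite ltrDl.
  move=> /(@nbhs_ballP R R^o)[e /= e0 eK].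
  have hK u : `|u| <= e / 2 -> `|iter m.+2 (@velocity R R^o) h u| <= K.
    move=> ue; apply: eK; rewrite /ball/= sub0r normrN; apply: le_lt_trans ue _.
    by rewrite ltr_pdivrMr// ltr_pMr// ltr1n.
  apply: (@has_deriv_quadratic _ _ _ _ K); near=> u.
  rewrite add0r /remainder eqxx; have [->|u0] := eqVneq u 0.
    by rewrite subrr mul0r subr0 normr0 expr0n mulr0.
  have ue : `|u| <= e / 2.
    near: u; have e2 : 0 < e / 2 by rewrite divr_gt0.
    by apply: filterS (@nbhs0_lt R R^o _ e2) => u /ltW.
  have := taylor_bound sh hK ue; rewrite !taylorS -!iterSr.
  set T := (taylor h m).[u]; set D0 : R := iter m _ h 0.
  set D1 : R := iter m.+1 _ h 0 => bd.
  have um : 0 < `|u| ^+ m by rewrite exprn_gt0// normr_gt0.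
  rewrite -(ler_pM2l um) -{1}normrX -normrM.
  move: bd; rewrite -addn2 exprD [`|u| ^+ 2]real_normK ?num_real//.
  rewrite [K * _]mulrCA; apply: le_trans; rewrite le_eqVlt; apply/orP; left.
  apply/eqP; congr (`| _ |); rewrite factS natrM -natr1 exprS.
  field; rewrite f0 expf_neq0//= natr1 pnatr_eq0//.
pose g (s : R) := (h s - (taylor h m).[s]) * (s ^- m).
apply: (@near_deriv _ _ g).
  have : \forall s \near (t : R), s != 0.
    have nt : 0 < `|t : R| by rewrite normr_gt0.
    apply: filterS (@cvgr_norm_gt R R^o _ _ _ id (t : R) cvg_id _ nt) => s.
    by rewrite normr_gt0.
  by apply: filterS => s s0; rewrite /g /remainder (negPf s0).
have dh := has_deriv_is_derive (smooth_has_deriv hausdorff_real sh (t := t)).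
apply: is_derive_has_deriv.
have dX : is_derive t (1 : R) (fun s : R => s ^+ m) (m%:R * t ^+ m.-1).
  have := is_derive_poly ('X^m) t; rewrite derivXn hornerMn hornerXn mulr_natl.
  by congr is_derive; apply/funext => s; rewrite hornerXn.
have dV : is_derive t (1 : R) (fun s : R => s ^- m)
    (- (t ^+ m) ^- 2 *: (m%:R * t ^+ m.-1)).
  by apply: is_deriveV => //; rewrite expf_neq0.
have dB : is_derive t (1 : R) (fun s : R => h s - (taylor h m).[s])
    (velocity h t - (taylor h m)^`().[t]).
  exact: is_deriveB dh (is_derive_poly _ _).
have := is_deriveM dB dV; move=> /is_derive_eq; apply.
rewrite /remainder (negPf t0) taylorS /GRing.scale/=.
case: m @g dX dV dB => [|m] g dX dV dB.
  have T0 f : taylor f 0 = 0 by rewrite /taylor poly_def big_ord0.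
  rewrite !T0 deriv0 !horner0 !expr0 !mul0r !mulr0 oppr0 mul0r !addr0 add0r.
  by rewrite invr1 mul1r mulr1.
rewrite deriv_taylor (taylorS (velocity h)) -iterSr /= factS natrM exprS.
have m0 : m.+1%:R != 0 :> R by rewrite pnatr_eq0.
have x0 : t ^+ m != 0 by rewrite expf_neq0.
move: (f0 m) m0 x0; rewrite expr1 ![t ^+ _.+1]exprS.
move: (m.+1%:R : R) (m`!%:R : R) (t ^+ m) (taylor h m.+1).[t].
move: (taylor (velocity h) m).[t] (velocity _ 0) => T' D N f x T fn Nn xn.
by field; rewrite fn Nn xn t0.
Unshelve. all: by end_near. Qed.

Lemma smooth_remainder (h : R^o -> R^o) m : smooth_curve h ->
  smooth_curve (remainder h m).
Proof.
move=> sh; apply/(smooth_curveP _ hausdorff_real) => n.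
elim: n h m sh => // n IH h m sh.
exists (fun t => remainder (velocity h) m t + (- m%:R) * remainder h m.+1 t); split.
  by move=> t; exact: has_deriv_remainder.
apply: ndiffD; first by apply: IH; exact: smooth_velocity.
by apply: ndiffZ (IH _ _ sh); exact: ndiff_cst.
Qed.

End Hadamard.

(** * Calculus of smooth maps on c-infinity-open sets *)

Section SmoothMaps.
Context {R : realType}.
Implicit Types E G : tvsType R.

(** Composition with such a parameter turns a curve that stays in an open set for
    small times into one that always does, with the same germ at [0]. *)
Lemma confining_parameter (e : R) : 0 < e -> exists2 rho : R^o -> R^o,
  smooth_curve rho & (forall t : R, `|rho t| <= e) /\
    exists2 r : R, 0 < r & forall t : R, `|t| <= r -> rho t = t.
Proof.
move=> e0; have [phi sphi [phi1 phi0]] := @plateau R.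
have [C C0 phiC] := iter_velocity_bounded 0 sphi phi0.
pose y := 2 * C / e; have y0 : 0 < y by rewrite !divr_gt0// mulr_gt0.
exists (fun t => t * phi (0 + y * t)).
  apply: smoothM; first exact: smooth_id.
  exact: (smooth_comp hausdorff_real (smooth_affine 0 y) sphi).
split=> [t|].
  rewrite add0r normrM; have [ty|ty] := ltP 2 `|y * t|.
    by rewrite phi0// normr0 mulr0 ltW.
  have te : `|t| <= e / C.
    move: ty; rewrite normrM (gtr0_norm y0) mulrC -ler_pdivlMr//.
    by rewrite (_ : 2 / y = e / C)// /y; field; rewrite !gt_eqF.
  rewrite (_ : e = e / C * C); last by rewrite divfK ?gt_eqF.
  by apply: ler_pM => //; exact: phiC.
exists y^-1; first by rewrite invr_gt0.
move=> t ty; rewrite phi1 ?mulr1// add0r normrM (gtr0_norm y0).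
by rewrite -ler_pdivlMl// mulr1.
Qed.

Lemma smooth_on_eq E G (U : set E) (f g : E -> G) :
  (forall x, U x -> f x = g x) -> smooth_on U f -> smooth_on U g.
Proof.
move=> fg sf c sc Uc; have := sf c sc Uc; congr smooth_curve.
by apply/funext => t /=; exact: fg.
Qed.

Lemma smooth_on_cst E G (U : set E) (x : G) : hausdorff_space G ->
  smooth_on U (fun=> x).
Proof. by move=> hG c sc Uc; exact: smooth_cst. Qed.

Lemma smooth_onD E G (U : set E) (f g : E -> G) : hausdorff_space G ->
  smooth_on U f -> smooth_on U g -> smooth_on U (fun x => f x + g x).
Proof. by move=> hG sf sg c sc Uc; apply: smoothD => //; [exact: sf|exact: sg]. Qed.

Section AlongLines.
Variables (E G : tvsType R) (U : set E) (f : E -> G).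
Hypotheses (hE : hausdorff_space E) (hG : hausdorff_space G).
Hypotheses (oU : cinfty_open U) (sf : smooth_on U f).

Lemma smooth_affine_curve (x v : E) : smooth_curve (fun t : R^o => x + t *: v).
Proof.
apply: smoothD => //; first exact: smooth_cst.
by apply: smoothZ => //; [exact: smooth_id|exact: smooth_cst].
Qed.

Lemma near_in_cinfty (c : R^o -> E) (t : R^o) : smooth_curve c -> U (c t) ->
  \forall u \near t, U (c u).
Proof. by move=> sc Uc; have /open_nbhs_nbhs := conj (oU sc) Uc; apply. Qed.

Lemma near_line (x v : E) : U x -> \forall t \near (0 : R^o), U (x + t *: v).
Proof.
move=> Ux; apply: near_in_cinfty; first exact: smooth_affine_curve.
by rewrite scale0r addr0.
Qed.

(** The definition of smooth maps only tests curves that stay in the open set for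
    all times. *)
Lemma smooth_near (c : R^o -> E) (t : R^o) : smooth_curve c -> U (c t) ->
  exists2 d, smooth_curve d & \forall u \near t, f (c u) = d u.
Proof.
move=> sc Uc; have Uc0 : U (c (t + 1 * 0)) by rewrite mulr0 addr0.
have sct : smooth_curve (fun u : R^o => c (t + 1 * u)).
  exact: (smooth_comp hE (smooth_affine t 1) sc).
have /(@nbhs_ballP R R^o)[e /= e0 eU] := near_in_cinfty sct Uc0.
have e2 : 0 < e / 2 by rewrite divr_gt0.
have [rho srho [rhoe [r r0 rhor]]] := confining_parameter e2.
exists (fun u => f (c (t + 1 * rho (- t + 1 * u)))).
  have srt : smooth_curve (fun u : R^o => rho (- t + 1 * u) : R^o).
    exact: (smooth_comp hausdorff_real (smooth_affine _ _) srho).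
  apply: sf; first exact: (smooth_comp hE srt sct).
  move=> u; apply: eU; rewrite /ball/= sub0r normrN.
  by apply: le_lt_trans (rhoe _) _; rewrite ltr_pdivrMr// ltr_pMr// ltr1n.
apply: filterS (@cvgr_dist_lt R R^o _ _ _ id (t : R) cvg_id _ r0) => u tu.
have tur : `|- t + 1 * u| <= r by rewrite mul1r addrC distrC ltW.
by rewrite (rhor _ tur) !mul1r addrA subrr add0r.
Qed.

Lemma dirD_deriv (x v : E) : U x ->
  has_deriv (fun t : R^o => f (x + t *: v)) 0 (dirD f x v).
Proof.
move=> Ux; have Ux0 : U (x + (0 : R) *: v) by rewrite scale0r addr0.
have [d sd fd] := smooth_near (smooth_affine_curve x v) Ux0.
have D : has_deriv (fun t : R^o => f (x + t *: v)) 0 (velocity d 0).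
  apply: near_deriv (smooth_has_deriv hG sd (t := 0)).
  by apply: filterS fd => u ->.
by rewrite (dirD_eq hG D).
Qed.

End AlongLines.
Arguments dirD_deriv {E G U f} hE hG oU sf {x} v Ux.

Lemma dirD_near E G (U : set E) (f g : E -> G) (x v : E) :
  hausdorff_space E -> cinfty_open U -> (forall y, U y -> f y = g y) -> U x ->
  dirD f x v = dirD g x v.
Proof.
move=> hE oU fg Ux; rewrite /dirD; congr (xget _ _); apply/funext => l.
have fgl (p q : E -> G) : (forall y, U y -> p y = q y) ->
    slope p x v h @[h --> 0^'] --> l -> slope q x v h @[h --> 0^'] --> l.
  move=> pq; apply: cvg_trans; apply: near_eq_cvg.
  have := nbhs_dnbhs (near_line hE oU v Ux); apply: filterS => h Uh.
  by rewrite /slope !pq.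
by apply/propext; split; apply: fgl => // y Uy; rewrite fg.
Qed.

Lemma dirDB E (U : set E) (f g : E -> R^o) (x v : E) : hausdorff_space E ->
  cinfty_open U -> smooth_on U f -> smooth_on U g -> U x ->
  dirD (fun y => f y - g y) x v = dirD f x v - dirD g x v.
Proof.
move=> hE oU sf sg Ux; apply: (dirD_eq hausdorff_real).
have Df := dirD_deriv hE hausdorff_real oU sf v Ux.
have Dg := dirD_deriv hE hausdorff_real oU sg v Ux.
have := has_derivD Df (has_derivZ (has_deriv_cst (-1 : R^o) _) Dg).
rewrite scale0r addr0 scaleN1r.
by under eq_fun do rewrite scaleN1r.
Qed.

Lemma dirD_add E (U : set E) (f g : E -> R^o) (x v : E) : hausdorff_space E ->
  cinfty_open U -> smooth_on U f -> smooth_on U g -> U x ->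
  dirD (fun y => f y + g y) x v = dirD f x v + dirD g x v.
Proof.
move=> hE oU sf sg Ux; apply: (dirD_eq hausdorff_real).
exact: has_derivD (dirD_deriv hE hausdorff_real oU sf v Ux)
  (dirD_deriv hE hausdorff_real oU sg v Ux).
Qed.

Lemma dirDZ E (U : set E) (k : R) (f : E -> R^o) (x v : E) : hausdorff_space E ->
  cinfty_open U -> smooth_on U f -> U x ->
  dirD (fun y => k * f y : R^o) x v = k * dirD f x v.
Proof.
move=> hE oU sf Ux; apply: (dirD_eq hausdorff_real).
have := has_derivZ (has_deriv_cst (k : R^o) _) (dirD_deriv hE hausdorff_real oU sf v Ux).
by rewrite scale0r addr0.
Qed.

Lemma dirD_cst E G (x : G) (y v : E) : hausdorff_space G ->
  dirD (fun=> x) y v = 0.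
Proof. by move=> hG; apply: (dirD_eq hG); exact: has_deriv_cst. Qed.

(** ** Reduction to the plane *)

(** Questions of calculus at a point concern two parameters only; confining both
    gives a function defined on the whole plane. *)
Lemma plane_localization E (U : set E) (f : E -> R^o) (Phi : R -> R -> E)
    (s0 t0 : R) :
  cinfty_open U -> smooth_on U f -> plane_smooth Phi -> U (Phi s0 t0) ->
  exists2 F : R -> R -> R^o, plane_smooth F & exists2 r : R, 0 < r &
    forall s t, `|s| <= r -> `|t| <= r ->
      F s t = f (Phi (s0 + s) (t0 + t)) /\ U (Phi (s0 + s) (t0 + t)).
Proof.
move=> oU sf sPhi U0.
have [e e0 eU] : exists2 e : R, 0 < e & forall s t, `|s - s0| <= e ->
    `|t - t0| <= e -> U (Phi s t).
  apply: near_plane => s t ss st s00 t00.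
  by apply: (near_in_cinfty oU (sPhi s t ss st)); rewrite s00 t00.
have [rho srho [rhoe [r r0 rhor]]] := confining_parameter e0.
have U1 s t : U (Phi (s0 + rho s) (t0 + rho t)).
  by apply: eU; rewrite addrAC subrr add0r.
exists (fun s t => f (Phi (s0 + rho s) (t0 + rho t))).
  move=> s t ss st; apply: sf => [|u]; last exact: U1.
  by apply: sPhi; apply: smoothD hausdorff_real _ _;
    (try exact: smooth_cst hausdorff_real); exact: smooth_comp hausdorff_real _ srho.
exists r => // s t sr tr; have := U1 s t.
by rewrite !rhor.
Qed.

Lemma velocity_near E (c d : R^o -> E) (t : R^o) : hausdorff_space E ->
  smooth_curve d -> (\forall u \near t, c u = d u) ->
  velocity c t = velocity d t.
Proof.
by move=> hE sd cd; have := nbhs_singleton (near_iter_velocity 1 hE sd cd).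
Qed.

(** Tested by linear functionals along a curve [c], this is the smoothness in [t] of
    the partial derivative of [Y (c t + s X (c t))] with respect to [s] at [0]. *)
Lemma smooth_dirD E G (U : set E) (Y : E -> G) (X : E -> E) :
  hausdorff_space E -> convenient G -> cinfty_open U ->
  smooth_on U Y -> smooth_on U X -> smooth_on U (fun y => dirD Y y (X y)).
Proof.
move=> hE [hG cG] oU sY sX c sc Uc; apply: cG => l cl.
have sf : smooth_on U (l \o Y).
  move=> d sd Ud; have := smooth_linear hG hausdorff_real cl (sY d sd Ud).
  by [].
apply: (smooth_local hausdorff_real) => t0.
pose Phi (s t : R) : E := c t + s *: X (c t).
have sPhi : plane_smooth Phi.
  move=> s t ss st; apply: smoothD => //; first exact: smooth_comp.
  by apply: smoothZ => //; apply: (smooth_comp hE st (sX c sc Uc)).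
have U0 : U (Phi 0 t0) by rewrite /Phi scale0r addr0.
have [F sF [r r0 Fr]] := plane_localization oU sf sPhi U0.
exists (fun u : R^o => pderiv F 1 1 0 (0 + 0 * u) (- t0 + 1 * u)).
  exact: smooth_pderiv.
apply: filterS (@cvgr_dist_lt R R^o _ _ _ id (t0 : R) cvg_id _ r0) => u tu.
have ur : `|u - t0| <= r by rewrite distrC ltW.
have D := dirD_deriv hE hG oU sY (X (c u)) (Uc u).
have := has_deriv_linear cl D; rewrite /= => Dl.
apply/esym/(velocity_eq hausdorff_real); apply: near_deriv Dl.
near=> v; have vr : `|v| <= r.
  by near: v; apply: filterS (@nbhs0_lt R R^o _ r0) => v /ltW.
rewrite mul0r addr0 mul1r mul0r addr0 [- t0 + _]addrC mul1r add0r.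
by have [-> _] := Fr v (u - t0) vr ur; rewrite /Phi/= add0r subrKC.
Unshelve. all: by end_near. Qed.

(** The velocity of [c] at [0] is the value at [0] of the smooth difference
    quotient [q], so [f (c t)] is the restriction to the diagonal of
    [f (c 0 + s q(t))]. *)
Lemma chain_rule E (U : set E) (f : E -> R^o) (c : R^o -> E) :
  convenient E -> cinfty_open U -> smooth_on U f -> smooth_curve c -> U (c 0) ->
  has_deriv (fun t => f (c t)) 0 (dirD f (c 0) (velocity c 0)).
Proof.
move=> [hE cE] oU sf sc Uc.
pose q (t : R^o) : E := if t == 0 then velocity c 0 else t^-1 *: (c t - c 0).
have cq t : c t = c 0 + t *: q t.
  rewrite /q; have [->|t0] := eqVneq t 0; first by rewrite scale0r addr0.
  by rewrite scalerA divff// scale1r subrKC.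
have sq : smooth_curve q.
  apply: cE => l cl.
  have sl : smooth_curve (l \o c) by exact: smooth_linear hE hausdorff_real cl sc.
  have := smooth_remainder 1 sl; congr smooth_curve; apply/funext => t.
  rewrite /remainder /q /=; case: eqVneq => [_|t0].
    rewrite divr1; apply: (velocity_eq hausdorff_real).
    have D := has_deriv_linear cl (smooth_has_deriv hE sc (t := 0)).
    exact: D.
  rewrite linearZ/= linearB/= expr1 /taylor horner_poly big_ord1/= divr1 expr0 mulr1.
  by rewrite mulrC.
pose Phi (s t : R) : E := c 0 + s *: q t.
have sPhi : plane_smooth Phi.
  move=> s t ss st; apply: smoothD => //; first exact: smooth_cst.
  by apply: smoothZ => //; exact: smooth_comp.
have U0 : U (Phi 0 0) by rewrite /Phi scale0r addr0.
have [F sF [r r0 Fr]] := plane_localization oU sf sPhi U0.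
have near_r : \forall t \near (0 : R), `|t| <= r.
  by apply: filterS (@nbhs0_lt R R^o _ r0) => t /ltW.
have zr : `|0 : R| <= r by rewrite normr0 ltW.
have D11 : has_deriv (fun t => f (c t)) 0 (pderiv F 1 1 1 0 0).
  have := smooth_has_deriv hausdorff_real (smooth_line sF 1 1 0 0) (t := 0).
  apply: near_deriv; apply: filterS (near_r) => t tr.
  by rewrite !mul1r !add0r; have [-> _] := Fr t t tr tr; rewrite /Phi !add0r -cq.
have D10 : pderiv F 1 1 0 0 0 = dirD f (c 0) (velocity c 0).
  apply: (velocity_eq hausdorff_real).
  apply: near_deriv (dirD_deriv hE hausdorff_real oU sf _ Uc).
  apply: filterS (near_r) => t tr; rewrite mul0r !add0r mul1r.
  by have [-> _] := Fr t 0 tr zr; rewrite /Phi !add0r /q eqxx.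
have D01 : pderiv F 1 0 1 0 0 = 0.
  apply: (velocity_eq hausdorff_real); apply: near_deriv (has_deriv_cst (f (c 0)) 0).
  apply: filterS (near_r) => t tr; rewrite mul0r !add0r mul1r.
  by have [-> _] := Fr 0 t zr tr; rewrite /Phi !add0r scale0r addr0.
by move: D11; rewrite -{1}[1]addr0 -{2}[1]add0r pderivD// D10 D01 addr0.
Qed.

(** Both sides are mixed derivatives of [f (x + s v + t w)] at the origin of the
    plane. *)
Lemma dirD_sym E (U : set E) (f : E -> R^o) (x v w : E) :
  hausdorff_space E -> cinfty_open U -> smooth_on U f -> U x ->
  dirD (fun y => dirD f y v) x w = dirD (fun y => dirD f y w) x v.
Proof.
move=> hE oU sf Ux; pose Phi (s t : R) : E := x + s *: v + t *: w.
have sPhi : plane_smooth Phi.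
  move=> s t ss st; apply: smoothD => //; last first.
    by apply: smoothZ => //; exact: smooth_cst.
  apply: smoothD => //; first exact: smooth_cst.
  by apply: smoothZ => //; exact: smooth_cst.
have U0 : U (Phi 0 0) by rewrite /Phi !scale0r !addr0.
have [F sF [r r0 Fr]] := plane_localization oU sf sPhi U0.
have near_r : \forall t \near (0 : R), `|t| <= r.
  by apply: filterS (@nbhs0_lt R R^o _ r0) => t /ltW.
have zr : `|0 : R| <= r by rewrite normr0 ltW.
have [l [D1 D2]] := pderiv_sym sF 1 0 0 1 0 0.
have E1 : dirD (fun y => dirD f y v) x w = l.
  apply: (dirD_eq hausdorff_real); apply: near_deriv D1.
  apply: filterS (near_r) => t tr; rewrite mul0r mul1r !add0r.
  have Ut : U (x + t *: w).
    by have [_] := Fr 0 t zr tr; rewrite /Phi !add0r scale0r addr0.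
  apply: (velocity_eq hausdorff_real).
  apply: near_deriv (dirD_deriv hE hausdorff_real oU sf v Ut).
  apply: filterS (near_r) => s sr; rewrite mul0r mul1r add0r addr0.
  by have [-> _] := Fr s t sr tr; rewrite /Phi !add0r addrAC.
rewrite E1; apply/esym/(dirD_eq hausdorff_real); apply: near_deriv D2.
apply: filterS (near_r) => t tr; rewrite mul0r mul1r !add0r.
have Ut : U (x + t *: v).
  by have [_] := Fr t 0 tr zr; rewrite /Phi !add0r scale0r addr0.
apply: (velocity_eq hausdorff_real).
apply: near_deriv (dirD_deriv hE hausdorff_real oU sf w Ut).
apply: filterS (near_r) => s sr; rewrite mul0r mul1r add0r addr0.
by have [-> _] := Fr t s tr sr; rewrite /Phi !add0r.
Qed.

End SmoothMaps.

(** * Curvature in one chart *)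

Section ChartGeometry.
Context {R : realType}.
Variables (E : tvsType R) (U : set E).
Variables (g : E -> E -> E -> R^o) (Gam : E -> E -> E -> E).
Hypotheses (cE : convenient E) (oU : cinfty_open U).
Hypothesis g_inner : forall x, U x ->
  [/\ bilinear_map (g x), forall v w, g x v w = g x w v &
      forall v, v != 0 -> 0 < g x v v].
Hypothesis g_smooth : smooth_on [set z : E * E * E | U z.1.1]
  (fun z => g z.1.1 z.1.2 z.2).
Hypothesis Gam_smooth : smooth_on [set z : E * E * E | U z.1.1]
  (fun z => Gam z.1.1 z.1.2 z.2).
Hypothesis torsion_free : forall X Y, smooth_on U X -> smooth_on U Y ->
  forall x, U x -> lcov Gam X Y x - lcov Gam Y X x = lbracket X Y x.
Hypothesis metric_compatible : forall X Y Z,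
  smooth_on U X -> smooth_on U Y -> smooth_on U Z -> forall x, U x ->
  dirD (fun y => g y (X y) (Y y)) x (Z x) =
  g x (lcov Gam Z X x) (Y x) + g x (X x) (lcov Gam Z Y x).

Let hE : hausdorff_space E := proj1 cE.

Lemma g_sym x v w : U x -> g x v w = g x w v.
Proof. by move=> /g_inner[]. Qed.

Lemma gDr x u v w : U x -> g x u (v + w) = g x u v + g x u w.
Proof.
move=> /g_inner[[gl _] _ _].
by have := gl u 1 v w; rewrite !scale1r.
Qed.

Lemma gDl x u v w : U x -> g x (u + v) w = g x u w + g x v w.
Proof. by move=> Ux; rewrite g_sym// gDr// ![g x w _]g_sym. Qed.

Lemma g0r x u : U x -> g x u 0 = 0.
Proof.
by move=> Ux; apply: (addrI (g x u 0)); rewrite -gDr// !addr0.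
Qed.

Lemma gNr x u v : U x -> g x u (- v) = - g x u v.
Proof.
by move=> Ux; apply/eqP; rewrite -subr_eq0 opprK -gDr// addNr g0r.
Qed.

Lemma gNl x u v : U x -> g x (- u) v = - g x u v.
Proof. by move=> Ux; rewrite g_sym// gNr// g_sym. Qed.

Lemma g_inj x u v : U x -> (forall w, g x u w = g x v w) -> u = v.
Proof.
move=> Ux uv; have [_ _ pos] := g_inner Ux; apply/eqP; rewrite -subr_eq0.
apply/negPn/negP => /pos; rewrite gDl// gNl// uv subrr.
by rewrite ltxx.
Qed.

Definition ip (X Y : E -> E) : E -> R^o := fun y => g y (X y) (Y y).

Lemma ipC X Y x : U x -> ip X Y x = ip Y X x.
Proof. exact: g_sym. Qed.

Lemma smooth_ip X Y : smooth_on U X -> smooth_on U Y -> smooth_on U (ip X Y).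
Proof.
move=> sX sY c sc Uc; apply: (g_smooth (c := fun t => (c t, X (c t), Y (c t)))) => //.
apply: smooth_pair => //; [exact: hausdorff_pair| |exact: sY].
by apply: smooth_pair => //; exact: sX.
Qed.

Lemma smooth_lcov X Y : smooth_on U X -> smooth_on U Y ->
  smooth_on U (lcov Gam X Y).
Proof.
move=> sX sY; apply: smooth_onD => //; first exact: smooth_dirD.
move=> c sc Uc; apply: (Gam_smooth (c := fun t => (c t, X (c t), Y (c t)))) => //.
apply: smooth_pair => //; [exact: hausdorff_pair| |exact: sY].
by apply: smooth_pair => //; exact: sX.
Qed.

(** The direction enters a covariant derivative through its value at the point
    only, so it may be extended to a constant field. *)
Definition covd (X : E -> E) (x v : E) : E := lcov Gam (fun=> v) X x.

Lemma ip_deriv X Y x v : smooth_on U X -> smooth_on U Y -> U x ->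
  dirD (ip X Y) x v = g x (covd X x v) (Y x) + g x (X x) (covd Y x v).
Proof.
move=> sX sY Ux.
exact: (metric_compatible sX sY (@smooth_on_cst R E E U v hE) Ux).
Qed.

Lemma covd_cst x v w : covd (fun=> w) x v = Gam x v w.
Proof. by rewrite /covd /lcov dirD_cst// add0r. Qed.

Lemma Gam_sym x v w : U x -> Gam x v w = Gam x w v.
Proof.
move=> Ux; have sc u : smooth_on U (fun=> u : E) by exact: smooth_on_cst.
have := torsion_free (sc v) (sc w) Ux.
rewrite /lcov /lbracket !dirD_cst// !add0r oppr0 => /eqP.
by rewrite subr_eq0 => /eqP.
Qed.

(** A smooth field whose covariant derivative is a self-adjoint endomorphism;
    equivalently, the 1-form dual to the field is closed. *)
Definition closed_field (X : E -> E) : Prop := smooth_on U X /\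
  forall x, U x -> forall v w, g x (covd X x v) w = g x (covd X x w) v.

Lemma closed_fieldP X : smooth_on U X ->
  (forall x, U x -> forall v w,
    dirD (ip X (fun=> w)) x v = dirD (ip X (fun=> v)) x w) ->
  closed_field X.
Proof.
move=> sX dX; split=> // x Ux v w; have := dX x Ux v w.
have sc u : smooth_on U (fun=> u : E) by exact: smooth_on_cst.
by rewrite !ip_deriv// !covd_cst (Gam_sym v w Ux) => /addIr.
Qed.

(** Closedness is evaluated on constant fields, whose bracket vanishes. *)
Lemma closed_form_field (al : E -> E -> R^o) X : smooth_on U X ->
  (forall x, U x -> forall w, al x w = g x (X x) w) ->
  (forall Y Z, smooth_on U Y -> smooth_on U Z -> forall x, U x ->
    dirD (fun y => al y (Z y)) x (Y x) - dirD (fun y => al y (Y y)) x (Z x)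
    - al x (lbracket Y Z x) = 0) ->
  closed_field X.
Proof.
move=> sX alE dal; apply: closed_fieldP => // x Ux v w.
have sc u : smooth_on U (fun=> u : E) by exact: smooth_on_cst.
have := dal _ _ (sc v) (sc w) x Ux.
rewrite /lbracket !dirD_cst// subrr alE// g0r// subr0 => /eqP.
rewrite subr_eq0 => /eqP.
rewrite (dirD_near (g := ip X (fun=> w)) v hE oU _ Ux); last by move=> y Uy; exact: alE.
by rewrite (dirD_near (g := ip X (fun=> v)) w hE oU _ Ux) // => y Uy; exact: alE.
Qed.

(** The gradient of [ip C D] for closed fields [C] and [D] *)
Definition igrad (C D : E -> E) : E -> E :=
  fun x => lcov Gam D C x + lcov Gam C D x.

Section Gradient.
Variables C D : E -> E.
Hypotheses (clC : closed_field C) (clD : closed_field D).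

(** By compatibility with the metric and self-adjointness. *)
Lemma ip_igrad x v : U x -> dirD (ip C D) x v = g x (igrad C D x) v.
Proof.
move=> Ux; have [sC symC] := clC; have [sD symD] := clD.
rewrite ip_deriv// symC// [g x (C x) _]g_sym// symD//.
by rewrite -gDl.
Qed.

(** Second derivatives of functions are symmetric. *)
Lemma igrad_closed : closed_field (igrad C D).
Proof.
have [sC _] := clC; have [sD _] := clD.
apply: closed_fieldP => [|x Ux v w].
  by apply: smooth_onD => //; exact: smooth_lcov.
have EE u z : dirD (ip (igrad C D) (fun=> u)) x z =
    dirD (fun y => dirD (ip C D) y u) x z.
  by apply: (dirD_near z hE oU _ Ux) => y Uy; rewrite ip_igrad.
rewrite !EE; apply: (dirD_sym _ _ hE oU) => //; exact: smooth_ip.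
Qed.

(** Second derivatives of [ip C D] commute up to the bracket because the
    gradient is again a closed field. *)
Lemma ip_commutator X Y x : smooth_on U X -> smooth_on U Y -> U x ->
  dirD (fun y => dirD (ip C D) y (Y y)) x (X x)
  - dirD (fun y => dirD (ip C D) y (X y)) x (Y x) =
  g x (igrad C D x) (lbracket X Y x).
Proof.
move=> sX sY Ux; have [sW symW] := igrad_closed.
have EE Z z : dirD (fun y => dirD (ip C D) y (Z y)) x z =
    dirD (ip (igrad C D) Z) x z.
  by apply: (dirD_near z hE oU _ Ux) => y Uy; rewrite ip_igrad.
rewrite !EE !ip_deriv// symW// -torsion_free// gDr// gNr//.
by rewrite /covd /lcov; ring.
Qed.

End Gradient.

(** Koszul's formula; the brackets have been absorbed by self-adjointness. *)
Lemma koszul B C D x :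
  closed_field B -> closed_field C -> closed_field D -> U x ->
  ip (lcov Gam B C) D x = 2^-1 *
    (dirD (ip C D) x (B x) + dirD (ip B C) x (D x) - dirD (ip B D) x (C x)).
Proof.
move=> clB clC clD Ux; rewrite !ip_igrad// /igrad !gDl// /ip.
have [_ sB] := clB; have [_ sC] := clC; have [_ sD] := clD.
have E1 := sC x Ux (B x) (D x); have E2 := sD x Ux (C x) (B x).
have E3 := sB x Ux (C x) (D x).
by move: E1 E2 E3; rewrite /covd /lcov /= !gDl// => E1 E2 E3; lra.
Qed.

Section Curvature.
Variable x : E.
Hypothesis Ux : U x.

Definition second_deriv (X Y : E -> E) (f : E -> R^o) (x : E) : R :=
  dirD (fun y => dirD f y (Y y)) x (X x).

Lemma smooth_deriv_ip X Y Z : smooth_on U X -> smooth_on U Y -> smooth_on U Z ->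
  smooth_on U (fun y => dirD (ip Y Z) y (X y)).
Proof.
move=> sX sY sZ; apply: (@smooth_on_eq _ _ _ _
  (fun y => ip (lcov Gam X Y) Z y + ip Y (lcov Gam X Z) y)) => [y Uy|].
  by rewrite ip_deriv.
apply: smooth_onD; first exact: hausdorff_real.
  by apply: smooth_ip => //; exact: smooth_lcov.
by apply: smooth_ip => //; exact: smooth_lcov.
Qed.

Lemma deriv_koszul X Y Z W :
  closed_field X -> closed_field Y -> closed_field Z ->
  dirD (ip (lcov Gam X Y) Z) x W = 2^-1 *
    (dirD (fun y => dirD (ip Y Z) y (X y)) x W
     + dirD (fun y => dirD (ip X Y) y (Z y)) x W
     - dirD (fun y => dirD (ip X Z) y (Y y)) x W).
Proof.
move=> clX clY clZ; have [sX _] := clX; have [sY _] := clY; have [sZ _] := clZ.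
have sm := smooth_deriv_ip.
rewrite (dirD_near W hE oU (fun y Uy => koszul clX clY clZ Uy) Ux).
have s1 := sm _ _ _ sX sY sZ; have s2 := sm _ _ _ sZ sX sY.
have s3 := sm _ _ _ sY sX sZ.
have s12 := smooth_onD hausdorff_real s1 s2.
have s3N : smooth_on U (fun y => -1 * dirD (ip X Z) y (Y y) : R^o).
  move=> c sc Uc; apply: smoothM; first exact: smooth_cst hausdorff_real.
  exact: s3.
have s123 := smooth_onD hausdorff_real s12 s3N.
rewrite (_ : (fun y => _) = (fun y => 2^-1 * ((dirD (ip Y Z) y (X y)
    + dirD (ip X Y) y (Z y)) + -1 * dirD (ip X Z) y (Y y)))).
  rewrite (dirDZ _ W hE oU s123 Ux) (dirD_add W hE oU s12 s3N Ux).
  by rewrite (dirD_add W hE oU s1 s2 Ux) (dirDZ _ W hE oU s3 Ux) mulN1r.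
by apply/funext => y; rewrite mulN1r.
Qed.

(** Compatibility with the metric gives
    [<nabla_A nabla_B C, D> = A <nabla_B C, D> - <nabla_B C, nabla_A D>], and
    Koszul's formula turns [A <nabla_B C, D>] into second derivatives of inner
    products.  Commuting these to obtain the symmetric expression on the right
    produces brackets; what remains is an identity between inner products of the
    twelve vectors [nabla_X Y] with distinct [X] and [Y] among [A], [B], [C] and
    [D]. *)
Lemma curvature_chart A B C D :
  closed_field A -> closed_field B -> closed_field C -> closed_field D ->
  g x (lcov Gam A (lcov Gam B C) x - lcov Gam B (lcov Gam A C) x
       - lcov Gam (lbracket A B) C x) (D x) =
  4^-1 * (- second_deriv A C (ip D B) x + second_deriv A D (ip B C) x
          + second_deriv B C (ip D A) x - second_deriv B D (ip A C) x
          - second_deriv C A (ip D B) x + second_deriv C B (ip D A) x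
          + second_deriv D A (ip B C) x - second_deriv D B (ip A C) x) +
  4^-1 * (- g x (igrad C B x) (igrad D A x) + g x (igrad C A x) (igrad D B x)) +
  4^-1 * (g x (lbracket D A x) (lbracket B C x)
          - g x (lbracket D B x) (lbracket A C x)
          + 2 * g x (lbracket A B x) (lbracket C D x)).
Proof.
move=> clA clB clC clD; have [sC _] := clC; have [sD _] := clD.
have ipCE (X Y Z W : E -> E) :
    second_deriv X Y (ip Z W) x = second_deriv X Y (ip W Z) x.
  rewrite /second_deriv; apply: (dirD_near _ hE oU _ Ux) => y Uy.
  by apply: (dirD_near _ hE oU _ Uy) => z Uz; exact: ipC.
(* covariant derivatives of the two inner fields, moved across the metric *)
have compat (X Y : E -> E) : closed_field X -> closed_field Y ->
    g x (lcov Gam X (lcov Gam Y C) x) (D x) =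
    dirD (ip (lcov Gam Y C) D) x (X x) - g x (lcov Gam Y C x) (lcov Gam X D x).
  move=> [sX _] [sY _]; rewrite ip_deriv//; first by rewrite /covd /lcov addrK.
  exact: smooth_lcov.
have com X Y Z W : closed_field X -> closed_field Y -> closed_field Z ->
    closed_field W -> second_deriv X Y (ip Z W) x =
    second_deriv Y X (ip Z W) x + g x (igrad Z W x) (lbracket X Y x).
  move=> [sX _] [sY _] clZ clW.
  by rewrite -(ip_commutator clZ clW sX sY Ux) /second_deriv addrC subrK.
have brk : g x (lcov Gam (lbracket A B) C x) (D x) =
    g x (lcov Gam D C x) (lbracket A B x).
  by have [_ symC] := clC; exact: (symC x Ux (lbracket A B x) (D x)).
have g3 u v w z : g x (u - v - w) z = g x u z - g x v z - g x w z.
  by rewrite !gDl// !gNl.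
have tor X Y : closed_field X -> closed_field Y ->
    lbracket X Y x = lcov Gam X Y x - lcov Gam Y X x.
  by move=> [sX _] [sY _]; rewrite torsion_free.
rewrite g3 !compat// brk !deriv_koszul// -!/(second_deriv _ _ _ _).
rewrite (com A B C D)// (com C A D B)// (com C B D A)// (com D A B C)//.
rewrite (com D B A C)// (ipCE A C D B) (ipCE B C D A) /igrad !tor//.
have gs v w := g_sym v w Ux.
move: (second_deriv A C (ip B D) x) (second_deriv B C (ip A D) x)
  (second_deriv A D (ip B C) x) (second_deriv B D (ip A C) x)
  (second_deriv B A (ip C D) x) => s1 s2 s3 s4 s5.
move: (lcov Gam A B x) (lcov Gam B A x) (lcov Gam A C x) (lcov Gam C A x)
  (lcov Gam A D x) (lcov Gam D A x) (lcov Gam B C x) (lcov Gam C B x)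
  (lcov Gam B D x) (lcov Gam D B x) (lcov Gam C D x) (lcov Gam D C x).
move=> AB BA AC CA AD DA BC CB BD DB CD DC.
rewrite !(gDl, gNl, gDr, gNr)//.
by rewrite !(gs DC) !(gs CD) !(gs AD) !(gs DA) !(gs BD) !(gs DB); lra.
Qed.

End Curvature.
End ChartGeometry.

(** * From charts to the manifold *)

Section Global.
Context {R : realType} {M : manifold R}.

Lemma cinfty_open_cdom (i : chart M) : cinfty_open (@cdom R M i).
Proof. by have := @overlap_open R M i i; rewrite setIid. Qed.

Lemma param_cdom (i : chart M) x :
  cdom x -> dom i (param i x) /\ Defs.coord i (param i x) = x.
Proof. by move=> [p ip <-]; rewrite coordK. Qed.

Lemma dom_chart_at (p : M) : dom (chart_at p) p.
Proof. by rewrite /chart_at; case: cid. Qed.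

Lemma cdom_coord (i : chart M) (p : M) : dom i p -> cdom (Defs.coord i p).
Proof. by exists p. Qed.

Lemma overlap_coord (i j : chart M) (p : M) : dom i p -> dom j p ->
  overlap j (Defs.coord i p).
Proof. by move=> ip jp; exists p. Qed.

Lemma convenient_real : convenient R^o.
Proof.
split=> [|c lc]; first exact: hausdorff_real.
have := lc (@idfun R^o : {linear R^o -> R^o}); apply.
by move=> x; exact: cvg_id.
Qed.

Definition smooth_fun (f : M -> R^o) : Prop :=
  forall i : chart M, smooth_on (@cdom R M i) (f \o param i).

(** By the chain rule for the transition map; a value of [along X f] is defined by
    a chosen chart, which varies from point to point. *)
Lemma along_chart (X : vfield M) (f : M -> R^o) (i : chart M) (p : M) :
  smooth_field X -> smooth_fun f -> dom i p ->
  along X f p = dirD (f \o param i) (Defs.coord i p) (X i (Defs.coord i p)).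
Proof.
move=> [_ Xij] sf ip; rewrite /along; set j := chart_at p.
have jp : dom j p := dom_chart_at p.
set x := Defs.coord i p; set v := X i x.
have ox : overlap j x by exact: overlap_coord.
have tx : transition j x = Defs.coord j p by rewrite /transition /= coordK.
rewrite -tx Xij//; have [hi _] := model_convenient i.
have [hj _] := model_convenient j.
have sc : smooth_curve (fun t : R^o => x + t *: v) by exact: smooth_affine_curve.
have ox0 : overlap j (x + (0 : R) *: v) by rewrite scale0r addr0.
have [d sd cd] := smooth_near hi (@overlap_open R M i j)
  (@transition_smooth R M i j) sc ox0.
have d0 : d 0 = transition j x.
  by rewrite -(nbhs_singleton cd) scale0r addr0.
have vd : velocity d 0 = dirD (transition (i := i) j) x v.
  by rewrite dirD_line; apply/esym/(velocity_near hj sd).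
have Ud : cdom (d 0) by rewrite d0 tx; exact: cdom_coord.
have D := chain_rule (model_convenient j) (@cinfty_open_cdom j) (sf j) sd Ud.
rewrite -vd -d0; apply/esym/(dirD_eq hausdorff_real); apply: near_deriv D.
apply: filterS2 cd (near_line hi (@overlap_open R M i j) v ox) => t <- [q [iq jq] <-].
by rewrite /= !coordK.
Qed.

Lemma smooth_along (X : vfield M) (f : M -> R^o) :
  smooth_field X -> smooth_fun f -> smooth_fun (along X f).
Proof.
move=> sX sf i; have [hi _] := model_convenient i.
apply: (@smooth_on_eq _ _ _ _ (fun x => dirD (f \o param i) x (X i x))).
  by move=> x /param_cdom[ip E]; rewrite /= (along_chart sX sf ip) E.
by apply: (smooth_dirD hi convenient_real (@cinfty_open_cdom i) (sf i)); case: sX.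
Qed.

Lemma along2_chart (X Y : vfield M) (f : M -> R^o) (p : M) (i := chart_at p) :
  smooth_field X -> smooth_field Y -> smooth_fun f ->
  along X (along Y f) p =
  dirD (fun y => dirD (f \o param i) y (Y i y)) (Defs.coord i p)
    (X i (Defs.coord i p)).
Proof.
move=> sX sY sf; have ip : dom i p := dom_chart_at p.
rewrite (along_chart sX (smooth_along sY sf) ip).
have [hi _] := model_convenient i.
apply: (dirD_near _ hi (@cinfty_open_cdom i) _ (cdom_coord ip)) => y.
by move=> /param_cdom[iq E]; rewrite /= (along_chart sY sf iq) E.
Qed.

Lemma alongB (X : vfield M) (f h : M -> R^o) (p : M) :
  smooth_fun f -> smooth_fun h ->
  along X (fun q => f q - h q) p = along X f p - along X h p.
Proof.
move=> sf sh; set i := chart_at p; have ip : dom i p := dom_chart_at p.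
have [hi _] := model_convenient i.
exact: (dirDB _ hi (@cinfty_open_cdom i) (sf i) (sh i) (cdom_coord ip)).
Qed.

Variable (g : metric M).
Hypothesis wg : weak_riemannian g.

Let g_inner i x (Ux : @cdom R M i x) := let: And3 h _ _ := wg in h i x Ux.

Lemma inner_chart (X Y : vfield M) (i : chart M) (p : M) :
  smooth_field X -> smooth_field Y -> dom i p ->
  inner g X Y p = ip (@g i) (X i) (Y i) (Defs.coord i p).
Proof.
move=> [_ Xij] [_ Yij] ip; have [_ _ gij] := wg; rewrite /inner.
set j := chart_at p; have jp : dom j p := dom_chart_at p.
have ox : overlap j (Defs.coord i p) by exact: overlap_coord.
have tx : transition j (Defs.coord i p) = Defs.coord j p.
  by rewrite /transition /= coordK.
by rewrite -tx Xij// Yij// gij.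
Qed.

Lemma inner_param (X Y : vfield M) (i : chart M) x :
  smooth_field X -> smooth_field Y -> cdom x ->
  (inner g X Y \o param i) x = ip (@g i) (X i) (Y i) x.
Proof. by move=> sX sY /param_cdom[ip E]; rewrite /= (inner_chart sX sY ip) E. Qed.

Lemma smooth_inner (X Y : vfield M) :
  smooth_field X -> smooth_field Y -> smooth_fun (inner g X Y).
Proof.
move=> sX sY i; have [_ gs _] := wg.
apply: (@smooth_on_eq _ _ _ _ (ip (@g i) (X i) (Y i))).
  by move=> x Ux; rewrite inner_param.
by apply: (smooth_ip (model_convenient i) (gs i)); [case: sX|case: sY].
Qed.

Lemma innerC (X Y : vfield M) : inner g X Y = inner g Y X.
Proof.
apply/funext => p; rewrite /inner; have := cdom_coord (dom_chart_at p).
by move=> /g_inner[_ gC _]; rewrite gC.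
Qed.

Lemma inner_bracketC (X Y Z : vfield M) (p : M) :
  inner g Z (bracket X Y) p = - inner g Z (bracket Y X) p.
Proof.
have Ux := cdom_coord (dom_chart_at p); rewrite /inner.
rewrite -(gNr (@g_inner _) _ _ Ux); congr (g _ _ _).
by rewrite /bracket /lbracket opprB.
Qed.

Lemma along2_inner (X Y Z W : vfield M) (p : M) (i := chart_at p) :
  smooth_field X -> smooth_field Y -> smooth_field Z -> smooth_field W ->
  along X (along Y (inner g Z W)) p =
  second_deriv (X i) (Y i) (ip (@g i) (Z i) (W i)) (Defs.coord i p).
Proof.
move=> sX sY sZ sW; rewrite (along2_chart p sX sY (smooth_inner sZ sW)).
have [hi _] := model_convenient i.
have oi := @cinfty_open_cdom i.
apply: (dirD_near _ hi oi _ (cdom_coord (dom_chart_at p))) => y Uy.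
by apply: (dirD_near _ hi oi _ Uy) => z Uz; rewrite inner_param.
Qed.

Lemma sharpP (al : oneform M) i x w : gsmooth_form g al -> cdom x ->
  al i x w = @g i x (sharp g al x) w.
Proof.
move=> [ex _] Ux; rewrite /sharp; case: xgetP => [v _ ->//|no].
by have [v /no] := ex i x Ux.
Qed.

Lemma pairing_inner (al : oneform M) (X : vfield M) : gsmooth_form g al ->
  pairing al X = inner g (sharp g al) X.
Proof.
move=> gal; apply/funext => p; rewrite /pairing /inner sharpP//.
exact: cdom_coord (dom_chart_at p).
Qed.

Section LeviCivita.
Variable Gam : christoffel M.
Hypothesis LC : levi_civita g Gam.

Let g_smooth i := let: And3 _ h _ := wg in h i.
Let Gam_smooth i := let: And4 _ h _ _ := LC in h i.
Let tors i := let: And4 _ _ h _ := LC in h i.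
Let comp i := let: And4 _ _ _ h := LC in h i.

Lemma sharp_closed_field (al : oneform M) i :
  gsmooth_form g al -> closed_form al ->
  closed_field (@cdom R M i) (@g i) (@Gam i) (sharp g al (i := i)).
Proof.
move=> gal cal; have sal : smooth_on (@cdom R M i) (sharp g al (i := i)).
  by case: gal => _ [].
apply: (closed_form_field (model_convenient i) (@cinfty_open_cdom i)
  (@g_inner i) (@tors i) (@comp i) sal (al := al i)).
  by move=> x Ux w; exact: sharpP.
by move=> X Y sX sY x Ux; exact: cal.
Qed.

Lemma sharp_dfun_inner (al be : oneform M) (p : M) (i := chart_at p) :
  gsmooth_form g al -> gsmooth_form g be -> closed_form al -> closed_form be ->
  sharp g (dfun (inner g (sharp g al) (sharp g be))) (Defs.coord i p) =
  igrad (@Gam i) (sharp g al (i := i)) (sharp g be (i := i)) (Defs.coord i p).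
Proof.
move=> gal gbe cal cbe; have Ux := cdom_coord (dom_chart_at p).
have [hi _] := model_convenient i.
set x := Defs.coord i p.
have E w : dfun (inner g (sharp g al) (sharp g be)) x w =
    @g i x (igrad (@Gam i) (sharp g al (i := i)) (sharp g be (i := i)) x) w.
  rewrite -(ip_igrad (model_convenient i) (@g_inner i) (@comp i)
    (@sharp_closed_field al i gal cal) (@sharp_closed_field be i gbe cbe) _ Ux).
  apply: (dirD_near _ hi (@cinfty_open_cdom i) _ Ux) => y Uy.
  by rewrite inner_param//; [case: gal|case: gbe].
rewrite {1}/sharp; case: xgetP => [v _ vP|/(_ _ E)//].
by apply: (g_inj (@g_inner i) Ux) => w; rewrite -vP E.
Qed.

(** This is the vanishing of [d al (X, Y)]. *)
Lemma pairing_bracket (al : oneform M) (X Y : vfield M) :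
  gsmooth_form g al -> closed_form al -> smooth_field X -> smooth_field Y ->
  pairing al (bracket X Y) =
  (fun p => along X (inner g (sharp g al) Y) p
            - along Y (inner g (sharp g al) X) p).
Proof.
move=> gal cal sX sY; apply/funext => p; rewrite /pairing /along.
set i := chart_at p; have Ux := cdom_coord (dom_chart_at p).
have [hi _] := model_convenient i; have [_ sal] := gal.
have := cal i _ _ (proj1 sX i) (proj1 sY i) _ Ux; rewrite /ext_deriv => /eqP.
rewrite subr_eq0 => /eqP <-; congr (_ - _);
  apply: (dirD_near _ hi (@cinfty_open_cdom i) _ Ux) => y Uy;
  rewrite inner_param//; exact: sharpP.
Qed.

Lemma curvature_closed_forms (al be ga de : oneform M) (p : M) :
  gsmooth_form g al -> gsmooth_form g be ->
  gsmooth_form g ga -> gsmooth_form g de ->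
  closed_form al -> closed_form be -> closed_form ga -> closed_form de ->
  let a := sharp g al in let b := sharp g be in
  let c := sharp g ga in let d := sharp g de in
  inner g (curvature Gam a b c) d p =
  4^-1 *
     (- along a (along c (pairing de b)) p
      + along a (along d (pairing be c)) p
      + along b (along c (pairing de a)) p
      - along b (along d (pairing al c)) p
      - along c (along a (pairing de b)) p
      + along c (along b (pairing de a)) p
      + along d (along a (pairing be c)) p
      - along d (along b (pairing al c)) p) +
  4^-1 *
     (- coinner g (dfun (pairing ga b)) (dfun (pairing de a)) p
      + coinner g (dfun (pairing ga a)) (dfun (pairing de b)) p) +
  4^-1 *
     (inner g (bracket d a) (bracket b c) p
      - inner g (bracket d b) (bracket a c) p
      + 2 * inner g (bracket a b) (bracket c d) p).
Proof.
move=> gal gbe gga gde cal cbe cga cde a b c d.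
have [_ sa] := gal; have [_ sb] := gbe; have [_ sc] := gga; have [_ sd] := gde.
rewrite !pairing_inner// !along2_inner// /coinner.
set i := chart_at p; have Ux := cdom_coord (dom_chart_at p).
rewrite [inner g (sharp _ _) (sharp _ _) p]/inner.
rewrite [inner g (sharp _ (dfun (inner g c a))) (sharp _ _) p]/inner.
rewrite !sharp_dfun_inner//.
exact: (curvature_chart (model_convenient i) (@cinfty_open_cdom i) (@g_inner i)
  (@g_smooth i) (@Gam_smooth i) (@tors i) (@comp i) Ux
  (@sharp_closed_field al i gal cal) (@sharp_closed_field be i gbe cbe)
  (@sharp_closed_field ga i gga cga) (@sharp_closed_field de i gde cde)).
Qed.

End LeviCivita.
End Global.

(** * The curvature formulas *)

Theorem mainTheorem1 (R : realType) (M : manifold R) (g : metric M)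
    (Gam : christoffel M)
    (g_robust : robust g) (Gam_LC : levi_civita g Gam) :
  (forall al be ga de : oneform M,
     gsmooth_form g al -> gsmooth_form g be ->
     gsmooth_form g ga -> gsmooth_form g de ->
     closed_form al -> closed_form be -> closed_form ga -> closed_form de ->
     let a := sharp g al in let b := sharp g be in
     let c := sharp g ga in let d := sharp g de in
     let R1 p := 4^-1 *
       (- along a (along c (pairing de b)) p
        + along a (along d (pairing be c)) p
        + along b (along c (pairing de a)) p
        - along b (along d (pairing al c)) p
        - along c (along a (pairing de b)) p
        + along c (along b (pairing de a)) p
        + along d (along a (pairing be c)) p
        - along d (along b (pairing al c)) p) in
     let R2 p := 4^-1 *
       (- coinner g (dfun (pairing ga b)) (dfun (pairing de a)) p
        + coinner g (dfun (pairing ga a)) (dfun (pairing de b)) p) in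
     let R3 p := 4^-1 *
       (inner g (bracket d a) (bracket b c) p
        - inner g (bracket d b) (bracket a c) p
        + 2 * inner g (bracket a b) (bracket c d) p) in
     forall p : M,
       inner g (curvature Gam a b c) d p = R1 p + R2 p + R3 p)
  /\
  (forall al be : oneform M,
     gsmooth_form g al -> gsmooth_form g be ->
     closed_form al -> closed_form be ->
     let a := sharp g al in let b := sharp g be in
     let R1 p := 2^-1 *
       (along a (along a (coinner g be be)) p
        - (along a (along b (coinner g al be)) p
           + along b (along a (coinner g al be)) p)
        + along b (along b (coinner g al al)) p) in
     let R1' p := 2^-1 *
       (along a (pairing be (bracket a b)) p
        - along b (pairing al (bracket a b)) p) in
     let R2 p := 4^-1 *
       (coinner g (dfun (coinner g al be)) (dfun (coinner g al be)) p
        - coinner g (dfun (coinner g al al)) (dfun (coinner g be be)) p)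
     in
     let R3 p := - (3 / 4) * inner g (bracket a b) (bracket a b) p in
     forall p : M,
       R1 p = R1' p /\
       inner g (curvature Gam a b b) a p = R1 p + R2 p + R3 p).
Proof.
have [wg _ _] := g_robust; split.
  move=> al be ga de gal gbe gga gde cal cbe cga cde a b c d R1 R2 R3 p.
  exact: (curvature_closed_forms wg Gam_LC p gal gbe gga gde cal cbe cga cde).
move=> al be gal gbe cal cbe a b R1 R1' R2 R3 p.
have [_ sa] := gal; have [_ sb] := gbe.
have sab := smooth_inner wg sa sb; have sbb := smooth_inner wg sb sb.
have saa := smooth_inner wg sa sa.
have ba : inner g b a = inner g a b by exact: innerC.
split.
  rewrite /R1 /R1' /coinner -/a -/b.
  rewrite (pairing_bracket wg gal cal sa sb) (pairing_bracket wg gbe cbe sa sb).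
  rewrite -/a -/b ba.
  rewrite (alongB a p (smooth_along sa sbb) (smooth_along sb sab)).
  rewrite (alongB b p (smooth_along sa sab) (smooth_along sb saa)).
  rewrite -/a -/b; move: (along a (along a (inner g b b)) p).
  move: (along a (along b (inner g a b)) p) (along b (along a (inner g a b)) p).
  by move: (along b (along b (inner g a a)) p) => x y z t; ring.
rewrite (curvature_closed_forms wg Gam_LC p gal gbe gbe gal cal cbe cbe cal).
rewrite !(pairing_inner _ gal) !(pairing_inner _ gbe) /R1 /R2 /R3 /coinner.
rewrite -/a -/b ba [inner g (bracket a b) (bracket b a) p]inner_bracketC//.
have -> : inner g (bracket a a) (bracket b b) p = 0.
  have := inner_bracketC wg b b (bracket a a) p.
  by move: (inner g _ _ p) => x; lra.
rewrite [inner g (sharp g (dfun (inner g b b))) _]innerC//.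
move: (along a (along a (inner g b b)) p) (along b (along b (inner g a a)) p).
move: (along a (along b (inner g a b)) p) (along b (along a (inner g a b)) p).
move: (inner g (bracket a b) (bracket a b) p).
move: (inner g (sharp g (dfun (inner g a a))) (sharp g (dfun (inner g b b))) p).
move: (inner g (sharp g (dfun (inner g a b))) (sharp g (dfun (inner g a b))) p).
by move=> x y z s t u v; field.
Qed.
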